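(* Fix $h\in(0,1]$ and $\Delta t>0$, and let the sequence $(X_h^j, j\in\mathbb{N}_0)$ of $V_h$-valued random variables be given by the recursion $$X_h^{j+1} = D^{\mathrm{det}} X_h^j + D^{\mathrm{stoch},j} X_h^j,\qquad j\in\mathbb{N}_0,$$ where $D^{\mathrm{det}}\in L(V_h)$ is deterministic, the initial condition $X_h^0\in L^2(\Omega;V_h)$ is $\mathcal{F}_0$-measurable, and each $D^{\mathrm{stoch},j}$ is an $L(V_h)$-valued random variable such that for all $j\in\mathbb{N}_0$: (i) $D^{\mathrm{stoch},j}$ is $\mathcal{F}_{t_{j+1}}$-measurable and $\mathbb{E}[D^{\mathrm{stoch},j}\,|\,\mathcal{F}_{t_j}]=0$; (ii) $\mathbb{E}[\|D^{\mathrm{stoch},j}\|_{L(V_h)}^2]<\infty$; (iii) $\mathbb{E}[D^{\mathrm{stoch},j}\otimes D^{\mathrm{stoch},j}\,|\,\mathcal{F}_{t_j}]=\mathbb{E}[D^{\mathrm{stoch},j}\otimes D^{\mathrm{stoch},j}]$; (iv) $\mathbb{E}[D^{\mathrm{stoch},j}\otimes D^{\mathrm{stoch},j}]=\mathbb{E}[D^{\mathrm{stoch},0}\otimes D^{\mathrm{stoch},0}]$. Then the zero solution of the recursion is asymptotically mean-square stable if and only if $$\mathcal{S} = D^{\mathrm{det}}\otimes D^{\mathrm{det}} + \mathbb{E}[D^{\mathrm{stoch},0}\otimes D^{\mathrm{stoch},0}]\in L(V_h^{(2)})$$ satisfies $\rho(\mathcal{S})=\max_{i=1,\dots,N_h^2}|\lambda_i|<1$,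 where $\lambda_1,\dots,\lambda_{N_h^2}$ are the eigenvalues of $\mathcal{S}$ and $N_h=\dim V_h$. Furthermore, the zero solution is asymptotically mean-square stable if $\|\mathcal{S}\|_{L(V_h^{(2)})}<1$.
   Context: $(\Omega,\mathcal{A},(\mathcal{F}_t)_{t\ge0},P)$ is a complete filtered probability space satisfying the usual conditions; $H$ is a real separable Hilbert space; $V_h\subset H$ is a finite-dimensional subspace with the inner product and norm of $H$; $t_j=j\Delta t$. $L(V)$ denotes the bounded linear operators on $V$ with the operator norm. $V_h^{(2)}=V_h\otimes V_h$ is the Hilbert tensor product, with inner product determined by $\langle v_1\otimes v_2,w_1\otimes w_2\rangle=\langle v_1,w_1\rangle_H\langle v_2,w_2\rangle_H$; for $D_1,D_2\in L(V_h)$, $D_1\otimes D_2\in L(V_h^{(2)})$ is the operator with $(D_1\otimes D_2)(v\otimes w)=D_1v\otimes D_2w$. Eigenvalues are the complex eigenvalues, counted with multiplicity. The zero solution of the recursion is $X_{h,\mathrm{e}}^j=0$ for all $j\in\mathbb{N}_0$. It is mean-square stable if for every $\varepsilon>0$ there is $\delta>0$ such that $\mathbb{E}[\|X_h^j\|_H^2]<\varepsilon$ for all $j\in\mathbb{N}_0$ whenever ($X_h^0\in L^2(\Omega;V_h)$ is $\mathcal{F}_0$-measurable and) $\mathbb{E}[\|X_h^0\|_H^2]<\delta$. It is asymptotically mean-square stable if it is mean-square stable and there is $\delta>0$ such that $\mathbb{E}[\|X_h^0\|_H^2]<\delta$ implies $\lim_{j\to\infty}\mathbb{E}[\|X_h^j\|_H^2]=0$.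 *)

(* Defs.v *)
From HB Require Import structures.
From mathcomp Require Import all_boot all_order all_algebra.
From mathcomp Require Import sesquilinear complex.
From mathcomp Require Import all_classical all_reals all_analysis.

Set Implicit Arguments.
Unset Strict Implicit.
Unset Printing Implicit Defensive.

Import Order.TTheory GRing.Theory Num.Theory.
Import numFieldNormedType.Exports.

Local Open Scope classical_set_scope.
Local Open Scope ring_scope.

(* [subVectType S] is the type of elements of [S : pred H], seen as a
   finite-dimensional linear subspace of [H]; [\val] is the inclusion. *)
#[short(type="subVectType")]
HB.structure Definition SubVector (R : nzRingType) (H : lmodType R)
    (S : pred H) :=
  { W of @GRing.SubLmodule R H S W & Vector R W }.

Definition separable (T : topologicalType) :=
  exists2 A : set T, countable A & dense A.

Section Norms.
Context {R : realType}.

Definition opnorm (V : vectType R) (N : V -> R) (D : 'End(V)) : R :=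
  sup [set N (D v) | v in [set v | N v <= 1]].

Definition norm_open (E : zmodType) (N : E -> R) (U : set E) :=
  forall x, U x -> exists2 e : R, 0 < e & forall y, N (y - x) < e -> U y.

(* Borel measurability, for the topology of the norm [N], with respect to the
   sigma-algebra [G]. *)
Definition measurable_wrt (T : Type) (E : zmodType) (N : E -> R)
    (G : set_system T) (f : T -> E) :=
  forall U, norm_open N U -> G (f @^-1` U).

End Norms.

(* The inner product of [H] restricted to the subspace [W]. *)
Section SubInnerProduct.
Context {R : realType} {H : lmodType R} {S : pred H} {W : subVectType S}.
Variable ip : {dot H for idfun}.

Definition sub_ip (v w : W) : R := ip (\val v) (\val w).

Lemma sub_ip_bilinear :
  bilinear_for (GRing.Scale.Law.clone _ _ *%R _)
    (GRing.Scale.Law.clone _ _ (idfun \; *%R) _) sub_ip.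
Proof.
by split=> [w|v] a x y; rewrite /sub_ip linearP /= (linearPl, linearPr).
Qed.

Lemma sub_ip_hermitian v w : sub_ip v w = (-1) ^+ false * idfun (sub_ip w v).
Proof. exact: hermC. Qed.

Lemma sub_ip_gt0 v : v != 0 -> 0 < sub_ip v v.
Proof.
by move=> v0; apply: neq0_dnorm_gt0; rewrite -(raddf0 (\val : {additive W -> H})) (inj_eq val_inj).
Qed.

HB.instance Definition _ :=
  bilinear_isBilinear.Build R W W R _ _ sub_ip sub_ip_bilinear.
HB.instance Definition _ :=
  isHermitianSesquilinear.Build R W false idfun sub_ip sub_ip_hermitian.
HB.instance Definition _ := isDotProduct.Build R W sub_ip sub_ip_gt0.

End SubInnerProduct.

Section TensorSquare.
Context {R : realType}.

(* A Hilbert tensor product of [V] with itself (unique up to isometry): the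
   simple tensors span, and the inner product is determined by its values on
   them. *)
Record hilbert_tensor_square (V : vectType R) (ip : {dot V for idfun}) := {
  tensor_space :> vectType R ;
  tensor_ip : {dot tensor_space for idfun} ;
  tensor : {bilinear V -> V -> tensor_space} ;
  tensor_span : forall x : tensor_space, exists s : seq (V * V),
    x = \sum_(p <- s) tensor p.1 p.2 ;
  tensor_ipE : forall v1 v2 w1 w2 : V,
    tensor_ip (tensor v1 v2) (tensor w1 w2) = ip v1 w1 * ip v2 w2 }.

Context {V : vectType R} {ip : {dot V for idfun}}.
Variable V2 : hilbert_tensor_square ip.

Definition tensor_norm (x : V2) : R := Num.sqrt (tensor_ip V2 x x).

(* The operator [D1 (x) D2]; it exists and is unique by [tensor_opE] and
   [tensor_op_unique]. *)
Definition tensor_op (D1 D2 : 'End(V)) : 'End(V2) :=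
  xget 0 [set L : 'End(V2) | forall v w : V,
    L (tensor V2 v w) = tensor V2 (D1 v) (D2 w)].

Lemma tensor_op_unique (L1 L2 : 'End(V2)) :
  (forall v w, L1 (tensor V2 v w) = L2 (tensor V2 v w)) -> L1 = L2.
Proof.
move=> L12; apply/lfunP => x; have [s ->] := tensor_span x.
by rewrite !linear_sum; apply: eq_bigr => p _; exact: L12.
Qed.

Let n : nat := \dim {:V}.
Let e := vbasis {:V}.
Let c (i : 'I_n) (v : V) : R := coord e i v.
Let expand v : v = \sum_(i < n) c i v *: e`_i.
Proof. by apply: coord_vbasis; rewrite memvf. Qed.

Let comb (f g : V -> V) (A : 'M[R]_n) : V2 :=
  \sum_i \sum_j A i j *: tensor V2 (f e`_i) (g e`_j).

Let comb_linear f g : linear (comb f g).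
Proof.
move=> a A B; rewrite /comb scaler_sumr -big_split /=; apply: eq_bigr => i _.
rewrite scaler_sumr -big_split /=; apply: eq_bigr => j _.
by rewrite !mxE scalerDl scalerA.
Qed.

Let combL f g : {linear 'M[R]_n -> V2} :=
  HB.pack (comb f g) (GRing.isLinear.Build _ _ _ _ _ (comb_linear f g)).

Let comb_tensor (f g : {linear V -> V}) v w :
  comb f g (\matrix_(i, j) (c i v * c j w)) = tensor V2 (f v) (g w).
Proof.
rewrite [in RHS](expand v) [in RHS](expand w) (linear_sum f) (linear_sum g) linear_sumlz.
apply: eq_bigr => i _; rewrite linear_sum; apply: eq_bigr => j _.
by rewrite mxE !linearZ /= linearZl /= linearZ /= scalerA.
Qed.

Let ip0 (v : V) : (forall w, ip v w = 0) -> v = 0.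
Proof.
move=> v0; apply/eqP; apply: contraT => /(neq0_dnorm_gt0 (s := ip)).
by rewrite v0 ltxx.
Qed.

Let coord0 (a : 'I_n -> R) : \sum_i a i *: e`_i = 0 -> forall i, a i = 0.
Proof.
have /freeP := basis_free (vbasisP {:V}); exact.
Qed.

Let comb_inj : lker (linfun (combL id id)) == 0%VS.
Proof.
apply/lker0P/raddf_inj => A phiA0.
have A0 : comb id id A = 0 by rewrite -[RHS]phiA0 [RHS]lfunE.
apply/matrixP => i j; rewrite mxE.
have key v w : \sum_i \sum_j A i j * (ip e`_i v * ip e`_j w) = 0.
  have : tensor_ip V2 (comb id id A) (tensor V2 v w) = 0 by rewrite A0 linear0l.
  move=> AE; rewrite -[RHS]AE linear_sumlz; apply: eq_bigr => k _.
  rewrite linear_sumlz; apply: eq_bigr => l _.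
  by rewrite linearZl /= tensor_ipE.
have row w k : \sum_j A k j * ip e`_j w = 0.
  move: k; apply: coord0; apply: ip0 => v; rewrite linear_sumlz -[RHS](key v w).
  apply: eq_bigr => k _; rewrite linearZl /= mulr_suml.
  by apply: eq_bigr => l _; rewrite -mulrA [X in _ * X]mulrC.
move: j; apply: coord0; apply: ip0 => w; rewrite linear_sumlz -[RHS](row w i).
by apply: eq_bigr => k _; rewrite linearZl.
Qed.

Lemma tensor_opE (D1 D2 : 'End(V)) v w :
  tensor_op D1 D2 (tensor V2 v w) = tensor V2 (D1 v) (D2 w).
Proof.
have /(xgetPex 0) /(_ v w) // : exists L : 'End(V2), forall v w : V,
    L (tensor V2 v w) = tensor V2 (D1 v) (D2 w).
pose phi := linfun (combL id id).
exists (linfun (combL D1 D2) \o phi^-1)%VF => {}v {}w.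
rewrite -(comb_tensor idfun idfun) -(comb_tensor D1 D2).
have phiE A : comb idfun idfun A = phi A by rewrite lfunE.
by rewrite comp_lfunE phiE lker0_lfunK ?comb_inj// lfunE.
Qed.

End TensorSquare.

Section TensorSquareExistence.
Context {R : realType} {V : vectType R} (ip : {dot V for idfun}).

Let ipC v w : ip v w = ip w v.
Proof. by rewrite (@hermC R false idfun V ip v w) expr0 mul1r. Qed.

Let n : nat := \dim {:V}.

Let orthonormal_family k : (k <= n)%N ->
  exists e : 'I_k -> V, forall i j, ip (e i) (e j) = (i == j)%:R.
Proof.
elim: k => [|k IH] kn; first by exists (fun=> 0) => -[].
have [e eP] := IH (ltnW kn).
pose U := <<[seq e i | i <- enum 'I_k]>>%VS.
have /subvPn[v _ vU] : ~~ ({:V} <= U)%VS.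
  apply: contraL kn => /dimvS; rewrite -leqNgt => /leq_trans; apply.
  by rewrite (leq_trans (dim_span _))// size_map size_enum_ord.
pose w := v - \sum_i ip v (e i) *: e i.
have w0 : w != 0.
  apply: contraNneq vU => /eqP; rewrite subr_eq0 => /eqP ->.
  apply: memv_suml => i _; apply/memvZ/memv_span/map_f.
  by rewrite mem_enum.
have we i : ip w (e i) = 0.
  rewrite linearBl linear_sumlz (bigD1 i) //= big1 => [|j ji].
    by rewrite linearZl /= eP eqxx mulr1 addr0 subrr.
  by rewrite linearZl /= eP (negPf ji) mulr0.
pose u := (Num.sqrt (ip w w))^-1 *: w.
have uu : ip u u = 1.
  have ww : 0 < ip w w by exact: neq0_dnorm_gt0.
  rewrite linearZl linearZr /= mulrA -expr2 exprVn sqr_sqrtr ?ltW//.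
  by rewrite mulVf// gt_eqF.
have ue i : ip u (e i) = 0 by rewrite linearZl /= we mulr0.
exists (fun i => oapp e u (unlift ord_max i)) => i j.
case: unliftP => [i' ->|->]; case: unliftP => [j' ->|->] /=.
- by rewrite eP (inj_eq lift_inj).
- by rewrite ipC ue eq_sym (negPf (neq_lift _ _)).
- by rewrite ue (negPf (neq_lift _ _)).
- by rewrite uu eqxx.
Qed.

Lemma hilbert_tensor_square_exists : inhabited (hilbert_tensor_square ip).
Proof.
have [e eP] := orthonormal_family (leqnn n).
pose X : n.-tuple V := [tuple e i | i < n].
have Xi (i : 'I_n) : X`_i = e i by rewrite -tnth_nth tnth_mktuple.
have ip_sum (a : 'I_n -> R) j : ip (\sum_i a i *: e i) (e j) = a j.
  rewrite linear_sumlz (bigD1 j) //= big1 => [|i ij].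
    by rewrite linearZl /= eP eqxx mulr1 addr0.
  by rewrite linearZl /= eP (negPf ij) mulr0.
have Xfree : free X.
  apply/freeP => a a0 i; rewrite -(ip_sum a i).
  by under eq_bigr do rewrite -Xi; rewrite a0 linear0l.
have Xbasis : basis_of {:V} X.
  by rewrite basisEfree Xfree subvf size_tuple leqnn.
have expand v : v = \sum_i ip v (e i) *: e i.
  have vE : v = \sum_i coord X i v *: e i.
    rewrite [LHS](coord_basis Xbasis (memvf v)).
    by apply: eq_bigr => i _; rewrite Xi.
  rewrite [LHS]vE; apply: eq_bigr => i _; congr (_ *: _).
  by rewrite [in RHS]vE ip_sum.
pose D (A B : 'M[R]_n) : R := \sum_i \sum_j A i j * B i j.
have Dlin : bilinear_for (GRing.Scale.Law.clone _ _ *%R _)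
    (GRing.Scale.Law.clone _ _ (idfun \; *%R) _) D.
  split=> C a A B; rewrite /D /= mulr_sumr -big_split /=; apply: eq_bigr => i _;
    rewrite mulr_sumr -big_split /=; apply: eq_bigr => j _; rewrite !mxE.
    by rewrite mulrDl mulrA.
  by rewrite mulrDr mulrCA.
have Dsym A B : D A B = (-1) ^+ false * idfun (D B A).
  rewrite expr0 mul1r; apply: eq_bigr => i _; apply: eq_bigr => j _.
  exact: mulrC.
have Dpos A : A != 0 -> 0 < D A A.
  move=> A0; have Dge0 i : 0 <= \sum_j A i j * A i j.
    by apply: sumr_ge0 => j _; rewrite -expr2 sqr_ge0.
  rewrite lt_def sumr_ge0 // andbT; apply: contra_neq A0 => /eqP.
  rewrite psumr_eq0 // => /allP Ai; apply/matrixP => i j; rewrite mxE.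
  have := Ai i (mem_index_enum i); rewrite psumr_eq0 => [/allP Aij|k _].
    by have := Aij j (mem_index_enum j); rewrite -expr2 sqrf_eq0 => /eqP.
  by rewrite -expr2 sqr_ge0.
pose Dd : {dot 'M[R]_n for idfun} := HB.pack D
  (bilinear_isBilinear.Build R _ _ _ _ _ D Dlin)
  (isHermitianSesquilinear.Build R _ false idfun D Dsym)
  (isDotProduct.Build R _ D Dpos).
pose t v w : 'M[R]_n := \matrix_(i, j) (ip v (e i) * ip w (e j)).
have tlin : bilinear_for (GRing.Scale.Law.clone _ _ *:%R _)
    (GRing.Scale.Law.clone _ _ *:%R _) t.
  split=> C a A B; apply/matrixP => i j; rewrite !mxE linearDl linearZl /=.
    by rewrite mulrDl mulrA.
  by rewrite mulrDr mulrCA.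
pose tb : {bilinear V -> V -> 'M[R]_n} := HB.pack t
  (bilinear_isBilinear.Build R _ _ _ _ _ t tlin).
apply: inhabits; apply: (@Build_hilbert_tensor_square R V ip 'M[R]_n Dd tb).
- move=> A; exists [seq (A p.1 p.2 *: e p.1, e p.2) | p : 'I_n * 'I_n].
  rewrite big_map big_enum /=; apply/matrixP => i j.
  rewrite summxE (bigD1 (i, j)) //= big1 => [|[k l]].
    by rewrite mxE linearZl /= !eP !eqxx !mulr1 addr0.
  rewrite mxE linearZl /= !eP xpair_eqE negb_and.
  by case/orP => /negPf ->; rewrite ?(mulr0, mul0r).
- move=> v1 v2 w1 w2; rewrite /= /D.
  rewrite [in RHS](expand v1) linear_sumlz mulr_suml.
  apply: eq_bigr => i _; rewrite [in RHS](expand v2) linear_sumlz mulr_sumr.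
  apply: eq_bigr => j _.
  rewrite !mxE !linearZl /= [ip (e i) _]ipC [ip (e j) _]ipC.
  by congr (_ * _); rewrite mulrCA.
Qed.
End TensorSquareExistence.

Section SpectralRadius.
Context {R : realType}.

(* The roots in [R[i]] of the characteristic polynomial, with multiplicity. *)
Definition complex_eigenvalues (V : vectType R) (L : 'End(V)) : seq R[i] :=
  let e := vbasis {:V} in
  sval (closed_field_poly_normal
    (char_poly (map_mx (real_complex R) (passmx.mxof e e L)))).

Definition spectral_radius (V : vectType R) (L : 'End(V)) : R :=
  \big[Num.max/0]_(z <- complex_eigenvalues L) Normc.normc z.

End SpectralRadius.

Section Probability.
Context {R : realType} {d : measure_display} {T : measurableType d}.
Variable P : probability T R.

Record usual_conditions (F : R -> set_system T) : Prop := {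
  complete_space : measure_is_complete P ;
  filtration_sigma : forall t, 0 <= t -> sigma_algebra setT (F t) ;
  filtration_sub : forall t, 0 <= t -> F t `<=` measurable ;
  filtration_mono : forall s t, 0 <= s -> s <= t -> F s `<=` F t ;
  filtration_null : P.-negligible `<=` F 0 ;
  filtration_right_continuous : forall t, 0 <= t ->
    \bigcap_(s in [set s | t < s]) F s = F t }.

Section Expectation.
Variables (E : vectType R) (N : E -> R).

Definition bochner_integrable (f : T -> E) :=
  measurable_wrt N measurable f /\ ('E_P[N \o f] < +oo)%E.

(* [E[1_A f]], computed in coordinates; the value does not depend on the
   basis. *)
Definition vexpectation_on (A : set T) (f : T -> E) : E :=
  \sum_(i < \dim {:E})
    (\int[P]_(w in A) coord (vbasis {:E}) i (f w))%R *: (vbasis {:E})`_i.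

Definition vexpectation (f : T -> E) : E := vexpectation_on setT f.

(* [g] is a version of [E[f | G]]. *)
Definition is_cond_expectation (G : set_system T) (f g : T -> E) :=
  [/\ bochner_integrable f,
      bochner_integrable g,
      measurable_wrt N G g &
      forall A, G A -> vexpectation_on A g = vexpectation_on A f].

End Expectation.

Section Stability.
Variables (V : vectType R) (N : V -> R) (F0 : set_system T).
Variables (Ddet : 'End(V)) (Dstoch : nat -> T -> 'End(V)).

Fixpoint solution (X0 : T -> V) (j : nat) : T -> V :=
  if j is k.+1 then
    fun w => Ddet (solution X0 k w) + Dstoch k w (solution X0 k w)
  else X0.

Definition mean_square (X : T -> V) : \bar R := 'E_P[fun w => N (X w) ^+ 2].

Definition initial_condition (X0 : T -> V) :=
  measurable_wrt N F0 X0 /\ (mean_square X0 < +oo)%E.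

Definition mean_square_stable :=
  forall eps : R, 0 < eps -> exists2 delta : R, 0 < delta &
    forall X0, initial_condition X0 -> (mean_square X0 < delta%:E)%E ->
      forall j, (mean_square (solution X0 j) < eps%:E)%E.

Definition asymptotically_mean_square_stable :=
  mean_square_stable /\
  exists2 delta : R, 0 < delta &
    forall X0, initial_condition X0 -> (mean_square X0 < delta%:E)%E ->
      mean_square (solution X0 j) @[j --> \oo] --> 0%E.

End Stability.
End Probability.

(* Main.v *)
Require Import Defs.
From HB Require Import structures.
From mathcomp Require Import all_boot all_order all_algebra.
From mathcomp Require Import sesquilinear complex.
From mathcomp Require Import all_classical all_reals all_analysis.
From mathcomp Require Import measurable_realfun.
From mathcomp Require Import lra ring.

Set Implicit Arguments.
Unset Strict Implicit.
Unset Printing Implicit Defensive.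

Import Order.TTheory GRing.Theory Num.Theory.
Import numFieldNormedType.Exports.

Local Open Scope classical_set_scope.
Local Open Scope ring_scope.

(** The second moments [E[X_j (x) Y_j]] of two solutions evolve by
    [E[X_(j+1) (x) Y_(j+1)] = S E[X_j (x) Y_j]]: expanding in an orthonormal
    basis, every product of entries of [Ddet + Dstoch_j] has a constant
    conditional mean and can be pulled out of its product with the
    [F_(t_j)]-measurable entries of [X_j (x) Y_j].

    If the powers of [S] decay, so does the mean square, which is a linear
    functional of [E[X_j (x) X_j]]. Decay follows from [rho(S) < 1] by peeling
    off the factors of the Cayley-Hamilton identity
    [\prod_i (S - lambda_i) = 0] one at a time: if [u_(j+1) - lambda u_j] is
    [O(q^j)] with [|lambda| < q] then so is [u_j].

    Conversely, [S^j (v (x) w) = E[X_j (x) Y_j]] for the solutions started at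
    the constants [v] and [w], and its entries are bounded by
    [E|X_j|^2 + E|Y_j|^2]. Stability thus gives [S^j -> 0] on all of
    [V (x) V], including the antisymmetric tensors, hence [rho(S) < 1]. *)

(** * Spectral radius and decay of powers *)


Section GeometricDecay.
Context {R : realType}.
Implicit Types (z : R[i]) (q C : R).
Let normc : R[i] -> R := @Normc.normc R.

Lemma normc_ge0 z : 0 <= normc z.
Proof. by case: z => a b; exact: sqrtr_ge0. Qed.

Lemma normcX z j : normc (z ^+ j) = normc z ^+ j.
Proof.
elim: j => [|j IH]; first by rewrite !expr0 [LHS]Normc.normc1.
by rewrite !exprS -IH [LHS]Normc.normcM.
Qed.

Lemma normc_real (a : R) : normc (real_complex R a) = `|a|.
Proof. by rewrite /normc /= expr0n addr0 sqrtr_sqr. Qed.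

Lemma ler_normc_sum (I : finType) (f : I -> R[i]) :
  normc (\sum_i f i) <= \sum_i normc (f i).
Proof.
elim/big_ind2 : _ => [||//]; first by rewrite [normc 0]Normc.normc0.
by move=> u a v b ua vb; apply: le_trans (le_normcD _ _) _; exact: lerD.
Qed.

(** A bound [C' * q ^+ j] propagates through the recursion as soon as [C + normc z * C' <= q * C'].
    This is where the strict gap between [normc z] and [q] enters. *)
Lemma affine_recursion_decay (u : nat -> R[i]) z q C : normc z < q ->
  (forall j, normc (u j.+1 - z * u j) <= C * q ^+ j) ->
  exists C', forall j, normc (u j) <= C' * q ^+ j.
Proof.
move=> zq uC; have q0 : 0 < q by apply: le_lt_trans zq; exact: normc_ge0.
(* The first entry starts the induction, the second solves [C + normc z * C' <= q * C'] for [C']. *)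
pose C' := Num.max (normc (u 0%N)) (C / (q - normc z)).
exists C'; elim=> [|j IH]; first by rewrite expr0 mulr1 le_max lexx.
have -> : u j.+1 = (u j.+1 - z * u j) + z * u j by rewrite subrK.
apply: le_trans (le_normcD _ _) _.
apply: (@le_trans _ _ (C * q ^+ j + normc z * (C' * q ^+ j))).
  apply: lerD; first exact: uC.
  by rewrite [leLHS]Normc.normcM ler_wpM2l// normc_ge0.
rewrite mulrA -mulrDl exprS mulrA ler_pM2r ?exprn_gt0//.
have : C / (q - normc z) <= C' by rewrite le_max lexx orbT.
by rewrite ler_pdivrMr ?subr_gt0//; lra.
Qed.

(** The left factor [W] makes the induction on [s] possible: [W * (B - z%:M)] absorbs the head of
    the product, and the entries of [W * B ^+ j] then satisfy an affine recursion with multiplier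
    [z]. For empty [s] the hypothesis says [W = 0]. *)
Lemma mx_product_decay m (B W : 'M[R[i]]_m.+1) (s : seq R[i]) q a b :
  (forall z, z \in s -> normc z < q) ->
  W * \prod_(z <- s) (B - z%:M) = 0 ->
  exists C, forall j, normc ((W * B ^+ j) a b) <= C * q ^+ j.
Proof.
elim: s W => [|z s IH] W sq.
  rewrite big_nil mulr1 => ->; exists 0 => j.
  by rewrite mul0r mul0r mxE [leLHS]Normc.normc0.
rewrite big_cons mulrA => /IH[z' z's|C WC].
  by apply: sq; rewrite inE z's orbT.
apply: (@affine_recursion_decay _ z _ C); first by apply: sq; rewrite mem_head.
move=> j; apply: le_trans (WC j); rewrite le_eqVlt; apply/orP; left; apply/eqP.
have -> : W * (B - z%:M) * B ^+ j = W * B ^+ j.+1 - z *: (W * B ^+ j).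
  by rewrite mulrBr mulrBl -mulrA -exprS -scalemx1 -scalerAr mulr1 -scalerAl.
by move: (W * B ^+ j.+1) (W * B ^+ j) => M N; rewrite !mxE.
Qed.

Lemma mx_power_decay m (B : 'M[R[i]]_m) (s : seq R[i]) q a b :
  char_poly B = \prod_(z <- s) ('X - z%:P) ->
  (forall z, z \in s -> normc z < q) ->
  exists C, forall j, normc ((B ^+ j) a b) <= C * q ^+ j.
Proof.
case: m B a b => [|m] B a b; first by case: a.
move=> Bs sq; have [] := @mx_product_decay m B 1 s q a b sq.
  rewrite mul1r -[RHS](Cayley_Hamilton B) Bs rmorph_prod/=.
  by apply: eq_bigr => z _; rewrite rmorphB/= horner_mx_X horner_mx_C.
by move=> C BC; exists C => j; rewrite -[B ^+ j]mul1r.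
Qed.

Lemma mx_power_eigenvalue m (B : 'M[R[i]]_m) z : root (char_poly B) z ->
  exists2 v : 'rV[R[i]]_m, v != 0 & forall j, v *m B ^+ j = z ^+ j *: v.
Proof.
rewrite -eigenvalue_root_char => /eigenvalueP[v vB v0]; exists v => //.
elim=> [|j IH]; first by rewrite !expr0 scale1r mulmx1.
by rewrite exprSr -mulmxE mulmxA IH -scalemxAl vB scalerA -exprSr.
Qed.

Variable W : vectType R.
Implicit Types S : 'End(W).
Local Notation e := (vbasis {:W}).
Local Notation cmx S := (map_mx (real_complex R) (passmx.mxof e e S)).

Lemma char_poly_eigenvalues S :
  char_poly (cmx S) = \prod_(z <- complex_eigenvalues S) ('X - z%:P).
Proof.
rewrite /complex_eigenvalues; case: closed_field_poly_normal => s /= {1}->.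
by rewrite (monicP (char_poly_monic _)) scale1r.
Qed.

Lemma spectral_radius_lt1P S :
  reflect (forall z, z \in complex_eigenvalues S -> normc z < 1)
    (spectral_radius S < 1).
Proof.
apply: (iffP idP) => [S1 z zS|S1].
  by apply: le_lt_trans S1; apply: le_bigmax_seq zS isT.
by rewrite /spectral_radius big_seq; apply: bigmax_lt.
Qed.

Lemma spectral_radius_ge0 S : 0 <= spectral_radius S.
Proof. by rewrite /spectral_radius; apply: bigmax_ge_id. Qed.

(** Coordinates are row vectors, so matrices act on the right and the eigenvectors used below are
    left eigenvectors. *)
Lemma rVof_iter S j x :
  passmx.rVof e (iter j S x) = passmx.rVof e x *m (passmx.mxof e e S) ^+ j.
Proof.
elim: j => [|j IH]; first by rewrite mulmx1.
by rewrite iterS (passmx.rVof_app _ (vbasisP _)) IH -mulmxA mulmxE -exprSr.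
Qed.

Lemma coord_iter S j x k : coord e k (iter j S x) =
  \sum_l coord e l x * (passmx.mxof e e S ^+ j) l k.
Proof.
by rewrite passmx.coord_rVof rVof_iter mxE; apply: eq_bigr => l _; rewrite mxE.
Qed.

Lemma cmxX S j : cmx S ^+ j = map_mx (real_complex R) (passmx.mxof e e S ^+ j).
Proof.
elim: j => [|j IH]; first by rewrite !expr0 map_mx1.
by rewrite !exprS IH -!mulmxE map_mxM.
Qed.

Lemma spectral_radius_lt1_decay S : spectral_radius S < 1 ->
  exists2 q, 0 < q < 1 & forall x k, exists C, forall j,
    `|coord e k (iter j S x)| <= C * q ^+ j.
Proof.
move=> S1; exists ((spectral_radius S + 1) / 2).
  by have := spectral_radius_ge0 S; move: S1; lra.
set q := _ / _ => x k.
have Sq z : z \in complex_eigenvalues S -> normc z < q.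
  move=> zS; apply: (@le_lt_trans _ _ (spectral_radius S)).
    exact: le_bigmax_seq zS isT.
  by rewrite /q; move: S1; lra.
have /choice[f fP] l : exists C, forall j,
    normc ((cmx S ^+ j) l k) <= C * q ^+ j.
  exact: mx_power_decay (char_poly_eigenvalues S) Sq.
exists (\sum_l `|coord e l x| * f l) => j.
rewrite coord_iter (le_trans (ler_norm_sum _ _ _))// mulr_suml ler_sum// => l _.
rewrite normrM -mulrA ler_wpM2l//.
by have := fP l j; rewrite cmxX mxE normc_real.
Qed.

(** If [v] is a left eigenvector for [z] with [1 <= normc z], then [normc (v 0 k)] is at most the
    modulus of entry [k] of [v *m cmx S ^+ j]. That entry tends to 0, because the rows of the matrix
    powers are the coordinates of the iterates on basis vectors. *)
Lemma iter_cvg0_spectral_radius S :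
  (forall x k, coord e k (iter j S x) @[j --> \oo] --> (0 : R)) ->
  spectral_radius S < 1.
Proof.
move=> S0; apply/spectral_radius_lt1P => z zS.
have /mx_power_eigenvalue[v v0 vz] : root (char_poly (cmx S)) z.
  by rewrite char_poly_eigenvalues root_prod_XsubC.
have /rV0Pn[k vk] := v0.
rewrite ltNge; apply/negP => z1.
have vk0 : 0 < normc (v 0 k).
  rewrite lt_neqAle normc_ge0 andbT eq_sym; apply/eqP => /Normc.eq0_normc v0k.
  by rewrite v0k eqxx in vk.
have coordE (l : 'I_(\dim {:W})) j :
    coord e k (iter j S e`_l) = (passmx.mxof e e S ^+ j) l k.
  rewrite coord_iter (bigD1 l)//= big1 ?addr0 => [|l' l'l].
    by rewrite coord_free ?(basis_free (vbasisP _))// eqxx mul1r.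
  by rewrite coord_free ?(basis_free (vbasisP _))// eq_sym (negPf l'l) mul0r.
have Mcvg (l : 'I_(\dim {:W})) :
    `|(passmx.mxof e e S ^+ j) l k| @[j --> \oo] --> (0 : R).
  have := cvg_norm (S0 e`_l k); rewrite normr0; under eq_cvg do rewrite coordE.
  exact.
have : \sum_l normc (v 0 l) * `|(passmx.mxof e e S ^+ j) l k| @[j --> \oo]
    --> \sum_l normc (v 0 l) * 0.
  apply: (@cvg_big R^o) => [|l _]; first exact: add_continuous.
  by apply: cvgMr; exact: Mcvg.
rewrite big1 => [|l _]; last by rewrite mulr0.
move=> /cvgr_lt /(_ _ vk0)[j _ /(_ j (leqnn j))] /=; apply/negP.
rewrite -leNgt; apply: (@le_trans _ _ (normc ((v *m cmx S ^+ j) 0 k))).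
  rewrite vz mxE [leRHS]Normc.normcM ler_peMl ?normc_ge0// -/normc normcX.
  exact: exprn_ege1.
rewrite mxE (le_trans (ler_normc_sum _))// ler_sum// => l _.
by rewrite [leLHS]Normc.normcM cmxX mxE -/normc normc_real.
Qed.

End GeometricDecay.

(** * Operator norms in an orthonormal basis *)

Section OrthonormalBasis.
Context {R : realType} {W : vectType R} (ip : {dot W for idfun}).

(** The index is any finite type, so that products of basis vectors, indexed by pairs, fit the same
    notion. Spanning is stated as the Fourier expansion. *)
Definition orthonormal_basis (I : finType) (e : I -> W) :=
  (forall i j, ip (e i) (e j) = (i == j)%:R) /\
  (forall x, x = \sum_i ip x (e i) *: e i).

Lemma dotC x y : ip x y = ip y x.
Proof. by rewrite hermC expr0 mul1r. Qed.

Lemma dot_ge0 x : 0 <= ip x x.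
Proof.
by have [->|/(neq0_dnorm_gt0 (s := ip))/ltW//] := eqVneq x 0; rewrite linear0l.
Qed.

(** One Gram-Schmidt step: some [x] differs from its projection, and the normalised residual is the
    new vector. *)
Lemma orthonormal_extend k (e : 'I_k -> W) :
  (forall i j, ip (e i) (e j) = (i == j)%:R) -> ~ orthonormal_basis e ->
  exists e' : 'I_k.+1 -> W, forall i j, ip (e' i) (e' j) = (i == j)%:R.
Proof.
move=> eP /not_andP[//|/existsNP[x /eqP]]; rewrite -subr_eq0.
set w := x - _ => w0; have we i : ip w (e i) = 0.
  rewrite linearBl linear_sumlz (bigD1 i)//= big1 => [|j ji].
    by rewrite linearZl /= eP eqxx mulr1 addr0 subrr.
  by rewrite linearZl /= eP (negPf ji) mulr0.
pose u := (Num.sqrt (ip w w))^-1 *: w.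
have ue i : ip u (e i) = 0 by rewrite linearZl /= we mulr0.
exists (fun i => oapp e u (unlift ord_max i)) => i j.
case: unliftP => [i' ->|->]; case: unliftP => [j' ->|->] /=.
- by rewrite eP (inj_eq lift_inj).
- by rewrite dotC ue eq_sym (negPf (neq_lift _ _)).
- by rewrite ue (negPf (neq_lift _ _)).
rewrite eqxx linearZl linearZr /= mulrA -expr2 exprVn sqr_sqrtr ?dot_ge0//.
by rewrite mulVf// gt_eqF// neq0_dnorm_gt0.
Qed.

Lemma orthonormal_size k (e : 'I_k -> W) :
  (forall i j, ip (e i) (e j) = (i == j)%:R) -> (k <= \dim {:W})%N.
Proof.
move=> eP; have efree : free [tuple e i | i < k].
  apply/freeP => a a0 i.
  have : ip (\sum_i a i *: e i) (e i) = 0.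
    rewrite -[RHS](linear0l ip (e i)) -[in RHS]a0; congr (ip _ _).
    by apply: eq_bigr => j _; rewrite -tnth_nth tnth_mktuple.
  rewrite linear_sumlz (bigD1 i)//= big1 => [|j ji].
    by rewrite linearZl /= eP eqxx mulr1 addr0.
  by rewrite linearZl /= eP (negPf ji) mulr0.
by rewrite -[k](size_tuple [tuple e i | i < k]) -(eqP efree) dimvS ?subvf.
Qed.

(** If no orthonormal family were a basis, extension could go on forever and exceed the
    dimension. *)
Lemma orthonormal_basis_exists :
  exists k (e : 'I_k -> W), orthonormal_basis e.
Proof.
apply: contrapT => nobasis.
suff ex k : exists e : 'I_k -> W, forall i j, ip (e i) (e j) = (i == j)%:R.
  by have [e /orthonormal_size] := ex (\dim {:W}).+1; rewrite ltnn.
elim: k => [|k [e eP]]; first by exists (fun=> 0) => -[].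
by apply: orthonormal_extend eP _ => eb; apply: nobasis; exists k, e.
Qed.

Definition dot_norm x := Num.sqrt (ip x x).
Local Notation N := dot_norm.

Lemma dot_norm_ge0 x : 0 <= N x. Proof. exact: sqrtr_ge0. Qed.

Lemma sqr_dot_norm x : N x ^+ 2 = ip x x.
Proof. by rewrite sqr_sqrtr// dot_ge0. Qed.

Lemma dot_norm0 : N 0 = 0.
Proof. by rewrite /N linear0l sqrtr0. Qed.

Lemma dot_normZ a x : N (a *: x) = `|a| * N x.
Proof.
by rewrite /N linearZl linearZr /= mulrA -expr2 sqrtrM ?sqr_ge0// sqrtr_sqr.
Qed.

Lemma dot_normN x : N (- x) = N x.
Proof. by rewrite /N linearNl linearNr opprK. Qed.

Lemma dot_norm_eq0 x : N x = 0 -> x = 0.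
Proof.
move=> /eqP; rewrite sqrtr_eq0; apply: contraTeq => x0.
by rewrite -ltNge neq0_dnorm_gt0.
Qed.

Lemma dot_le_norm x y : ip x y <= N x * N y.
Proof.
have [/dot_norm_eq0->|x0] := eqVneq (N x) 0.
  by rewrite linear0l dot_norm0 mul0r.
have [/dot_norm_eq0->|y0] := eqVneq (N y) 0.
  by rewrite linear0r dot_norm0 mulr0.
have xy0 : 0 < N x * N y by rewrite mulr_gt0// lt_def ?x0 ?y0 dot_norm_ge0.
(* Cauchy-Schwarz: expanding this square gives the inequality multiplied by [N x * N y]. *)
have := dot_ge0 (N y *: x - N x *: y).
rewrite linearBl !linearBr /= !linearZl !linearZr /= [ip y x]dotC.
rewrite -!sqr_dot_norm.
move=> xy_ge0; rewrite -(ler_pM2l xy0); move: xy_ge0.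
by move: (N x) (N y) (ip x y) => a b c; nra.
Qed.

Lemma ler_dot_normD x y : N (x + y) <= N x + N y.
Proof.
rewrite -(@ler_pXn2r _ 2)// ?nnegrE ?addr_ge0 ?dot_norm_ge0//.
rewrite sqr_dot_norm linearDl !linearDr /= [ip y x]dotC sqrrD !sqr_dot_norm.
by have := dot_le_norm x y; rewrite mulr2n; lra.
Qed.

Section Basis.
Variables (I : finType) (e : I -> W).
Hypothesis eP : orthonormal_basis e.

Lemma dot_sumE x y : ip x y = \sum_i ip x (e i) * ip y (e i).
Proof.
rewrite [in LHS](eP.2 x) linear_sumlz; apply: eq_bigr => i _.
by rewrite linearZl /= [ip (e i) y]dotC.
Qed.

Lemma basis_norm i : N (e i) = 1.
Proof. by rewrite /N eP.1 eqxx sqrtr1. Qed.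

Lemma coord_le_norm x i : `|ip x (e i)| <= N x.
Proof.
rewrite -sqrtr_sqr ler_wsqrtr//  [ip x x]dot_sumE (bigD1 i)//= -expr2 lerDl.
by apply: sumr_ge0 => j _; rewrite -expr2 sqr_ge0.
Qed.

Lemma norm_le_coord x : N x <= \sum_i `|ip x (e i)|.
Proof.
rewrite [in leLHS](eP.2 x).
elim/big_ind2 : _ => [|u a v b ua vb|i _]; first by rewrite dot_norm0.
  by apply: le_trans (ler_dot_normD _ _) _; exact: lerD.
by rewrite dot_normZ basis_norm mulr1.
Qed.

End Basis.

Section OperatorNorm.
Local Notation opnorm := (opnorm N).
Implicit Types A B D : 'End(W).

(** Without boundedness the [sup] in [opnorm] would be a mere default value. On the unit ball the
    coordinates are at most 1 in modulus, so the sum of the absolute matrix entries is a bound. *)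
Lemma opnorm_has_ubound D : has_ubound [set N (D v) | v in [set v | N v <= 1]].
Proof.
have [k [e eP]] := orthonormal_basis_exists.
exists (\sum_i \sum_j `|ip (D (e j)) (e i)|) => _ [v v1 <-].
apply: le_trans (norm_le_coord eP _) _; apply: ler_sum => i _.
rewrite [in leLHS](eP.2 v) linear_sum linear_sumlz.
rewrite (le_trans (ler_norm_sum _ _ _))//.
apply: ler_sum => j _; rewrite linearZ linearZl /= normrM ler_piMl//.
exact: le_trans (coord_le_norm eP _ _) v1.
Qed.

Lemma le_opnorm1 D v : N v <= 1 -> N (D v) <= opnorm D.
Proof. by move=> v1; apply: ub_le_sup (opnorm_has_ubound D) _ _; exists v. Qed.

Lemma opnorm_ge0 D : 0 <= opnorm D.
Proof.
apply: (le_trans (dot_norm_ge0 (D 0))); apply: le_opnorm1.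
by rewrite dot_norm0.
Qed.

Lemma le_opnorm D v : N (D v) <= opnorm D * N v.
Proof.
have [v0|v0] := eqVneq (N v) 0.
  by rewrite v0 mulr0 (dot_norm_eq0 v0) linear0 dot_norm0.
have vgt0 : 0 < N v by rewrite lt_def v0 dot_norm_ge0.
have vi : `|(N v)^-1| = (N v)^-1 by rewrite ger0_norm// invr_ge0 ltW.
rewrite -ler_pdivrMr// mulrC -vi -dot_normZ -linearZ.
by apply: le_opnorm1; rewrite dot_normZ vi mulVf.
Qed.

Lemma opnorm_le D C : (forall v, N v <= 1 -> N (D v) <= C) -> opnorm D <= C.
Proof.
move=> DC; apply: ge_sup; last by move=> _ [v v1 <-]; exact: DC.
by exists (N (D 0)), 0; rewrite //= dot_norm0.
Qed.

Lemma ler_opnormD A B : opnorm (A + B) <= opnorm A + opnorm B.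
Proof.
apply: opnorm_le => v v1; rewrite add_lfunE.
by apply: le_trans (ler_dot_normD _ _) _; apply: lerD; exact: le_opnorm1.
Qed.

Lemma opnorm_sub_le A B : opnorm A - opnorm B <= opnorm (A - B).
Proof. by rewrite lerBlDr -[in leLHS](subrK B A) ler_opnormD. Qed.

Lemma opnormN A : opnorm (- A) = opnorm A.
Proof.
apply/le_anti/andP; split; apply: opnorm_le => v v1.
  by rewrite opp_lfunE dot_normN; exact: le_opnorm1.
by rewrite -[A in leLHS]opprK opp_lfunE dot_normN; exact: le_opnorm1.
Qed.

Lemma opnorm_lipschitz A B : `|opnorm A - opnorm B| <= opnorm (A - B).
Proof.
rewrite ler_norml opnorm_sub_le lerNl opprB.
by rewrite -[A - B]opprB opnormN opnorm_sub_le.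
Qed.

(** Expand [D] in the elementary operators [E i j]; each coefficient is a matrix entry, hence at
    most [opnorm D] in modulus. *)
Lemma linear_le_opnorm (l : {scalar 'End(W)}) :
  exists2 C, 0 < C & forall D, `|l D| <= C * opnorm D.
Proof.
have [k [e eP]] := orthonormal_basis_exists.
pose f i j (v : W) : W := ip v (e j) *: e i.
have flin i j : linear (f i j).
  by move=> a u v; rewrite /f linearDl linearZl scalerDl scalerA.
pose E i j : 'End(W) := linfun (HB.pack (f i j)
  (GRing.isLinear.Build _ _ _ _ _ (flin i j)) : {linear W -> W}).
(* The summand 1 keeps the constant positive, so that it can serve as a Lipschitz constant to divide
   by. *)
exists (1 + \sum_i \sum_j `|l (E i j)|) => [|D].
  by rewrite ltr_pwDl// sumr_ge0// => i _; exact: sumr_ge0.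
have DE : D = \sum_i \sum_j ip (D (e j)) (e i) *: E i j.
  apply/lfunP => v; rewrite sum_lfunE [LHS](eP.2 (D v)).
  apply: eq_bigr => i _; rewrite sum_lfunE [in LHS](eP.2 v).
  rewrite linear_sum linear_sumlz scaler_suml; apply: eq_bigr => j _.
  by rewrite scale_lfunE lfunE /= /f linearZ linearZl /= scalerA mulrC.
rewrite [in l _]DE mulrDl mul1r ler_wpDl ?opnorm_ge0// linear_sum /=.
rewrite (le_trans (ler_norm_sum _ _ _))// mulr_suml ler_sum// => i _.
rewrite linear_sum (le_trans (ler_norm_sum _ _ _))// mulr_suml ler_sum// => j _.
rewrite linearZ normrM mulrC ler_wpM2l//.
apply: le_trans (coord_le_norm eP _ _) _.
by rewrite (le_trans (le_opnorm _ _))// basis_norm// mulr1.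
Qed.

End OperatorNorm.
End OrthonormalBasis.

(** * Constant conditional expectations *)

Section ConditionalMean.
Import HBSimple HBNNSimple.
Context {R : realType} {d : measure_display} {T : measurableType d}.
Variable P : probability T R.
Implicit Types (G : set_system T) (f g : T -> R) (c : R).

Local Notation integrableR f := (P.-integrable setT (EFin \o f)).

Definition is_sub_sigma_algebra G := sigma_algebra setT G /\ G `<=` measurable.

(** Passing to the type generated by [G] gives access to the usual closure properties and to simple
    approximations; for a sigma-algebra this is measurability for [G] itself. *)
Definition measurable_for G f :=
  measurable_fun [set: g_sigma_algebraType G] (f : g_sigma_algebraType G -> R).

(* [E[f | G] = c] *)
Definition cond_mean G f c := integrableR f /\
  forall A, G A -> (\int[P]_(w in A) f w)%R = c * fine (P A).

Lemma integrableRD f g :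
  integrableR f -> integrableR g -> integrableR (fun w => f w + g w).
Proof. by move=> fi gi; exact: (integrableD measurableT fi gi). Qed.

Lemma integrableRZ c f : integrableR f -> integrableR (fun w => c * f w).
Proof. by move=> fi; exact: (integrableZl measurableT c fi). Qed.

Lemma integrableR_le f g : measurable_fun setT f ->
  (forall w, `|f w| <= g w) -> integrableR g -> integrableR f.
Proof.
move=> mf fg; apply: le_integrable => //; first exact/measurable_EFinP.
by move=> w _ /=; rewrite lee_fin (le_trans (fg w))// ler_norm.
Qed.

Lemma integrableR_measurable f : integrableR f -> measurable_fun setT f.
Proof. by move=> /measurable_int/measurable_EFinP. Qed.

Lemma integrableR_sum (I : Type) (s : seq I) (F : I -> T -> R) :
  (forall i, integrableR (F i)) ->
  integrableR (fun w => \sum_(i <- s) F i w) /\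
  \int[P]_w (\sum_(i <- s) F i w) = \sum_(i <- s) \int[P]_w F i w.
Proof.
move=> Fi; elim: s => [|i s [IHi IHe]].
  have -> : (fun w => \sum_(i <- [::]) F i w) = cst 0.
    by apply/funext => w; rewrite big_nil.
  by split; [exact: integrable0|rewrite big_nil Rintegral_cst// mul0r].
have -> : (fun w => \sum_(k <- i :: s) F k w) =
    (fun w => F i w + \sum_(k <- s) F k w).
  by apply/funext => w; rewrite big_cons.
split; [exact: integrableRD|rewrite big_cons -IHe RintegralD//]. 
Qed.

Lemma measurable_forP G f : is_sub_sigma_algebra G ->
  measurable_for G f <-> forall U, measurable U -> G (f @^-1` U).
Proof.
move=> [Gs Gm]; have GE : <<s G>> = G by exact: sigma_algebra_id.
split=> [mf U mU|mf _ U mU].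
  by have := mf measurableT U mU; rewrite setTI -[in X in _ -> X]GE.
by rewrite setTI; have := mf _ mU; rewrite -[in X in X -> _]GE.
Qed.

Lemma measurable_for_measurable G f : is_sub_sigma_algebra G ->
  measurable_for G f -> measurable_fun setT f.
Proof.
move=> Gs /(measurable_forP _ Gs) mf _ U mU; rewrite setTI.
by apply: Gs.2; exact: mf.
Qed.

Lemma cond_meanD G f g c c' : is_sub_sigma_algebra G ->
  cond_mean G f c -> cond_mean G g c' ->
  cond_mean G (fun w => f w + g w) (c + c').
Proof.
move=> [_ Gm] [fi fc] [gi gc]; split=> [|A GA]; first exact: integrableRD.
have mA := Gm _ GA.
have iA h : integrableR h -> P.-integrable A (EFin \o h).
  exact: integrableS.
by rewrite RintegralD//; [rewrite fc// gc// mulrDl|exact: iA|exact: iA].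
Qed.

Lemma Rintegral_indic A f : measurable A ->
  \int[P]_w (f w * \1_A w) = (\int[P]_(w in A) f w)%R.
Proof.
move=> mA; rewrite [RHS]Rintegral_mkcond; apply: eq_Rintegral => w _.
by rewrite patch_indic.
Qed.

Lemma integrableR_indic A f : measurable A -> integrableR f ->
  integrableR (fun w => f w * \1_A w).
Proof.
move=> mA fi; apply: (@integrableR_le _ (fun w => `|f w|)).
- apply: measurable_funM; first exact: integrableR_measurable.
  exact: measurable_indic.
- move=> w; rewrite normrM ler_piMr// indicE.
  by case: (_ \in _); rewrite ?normr0 ?normr1.
- by apply: (integrable_abse fi).
Qed.

(** A simple [h] is a finite combination of indicators of its level sets. These belong to [G], where
    the conditional mean of [f] is known. *)
Lemma cond_mean_simple G f c (h : {nnsfun (g_sigma_algebraType G) >-> R}) :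
  is_sub_sigma_algebra G -> cond_mean G f c ->
  integrableR (fun w => f w * h w) /\
  \int[P]_w (f w * h w) = c * \int[P]_w h w.
Proof.
move=> Gs [fi fc]; pose A y : set T := h @^-1` [set y].
have GA y : G (A y).
  by have /(measurable_forP _ Gs) := @measurable_funP _ _ _ _ setT h; exact.
have mA y : measurable (A y) by apply: Gs.2; exact: GA.
pose s := finmap.enum_fset (fset_set (range h)).
have hE w : h w = \sum_(y <- s) y * \1_(A y) w.
  by rewrite fimfunE fsbig_finite//; exact: fimfunP.
have -> : (fun w => f w * h w) = fun w => \sum_(y <- s) y * (f w * \1_(A y) w).
  apply/funext => w; rewrite hE mulr_sumr.
  by apply: eq_bigr => y _; rewrite mulrCA.
have [i e] := integrableR_sum s
  (fun y => integrableRZ y (integrableR_indic (mA y) fi)).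
split; first exact: i.
rewrite e; under [in RHS]eq_Rintegral do rewrite hE.
have i1 y : integrableR (\1_(A y)) by exact: integrable_indic.
have [_ ->] := integrableR_sum s (fun y => integrableRZ y (i1 y)).
rewrite mulr_sumr; apply: eq_bigr => y _.
rewrite !RintegralZl//; last exact: integrableR_indic.
rewrite Rintegral_indic// fc// mulrCA; congr (_ * (_ * _)).
rewrite -[RHS](_ : \int[P]_w (1 * \1_(A y) w) = _).
  by rewrite Rintegral_indic// Rintegral_cst// mul1r.
by apply: eq_Rintegral => w _; rewrite mul1r.
Qed.

Section Approximation.
Variables (G : set_system T) (g : T -> R).
Hypotheses (mg : measurable_for G g) (g0 : forall w, 0 <= g w).

Let mg' : measurable_fun [set: g_sigma_algebraType G] (EFin \o g).
Proof. exact/measurable_EFinP. Qed.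

(** The approximants are simple with respect to [G], not only to the ambient sigma-algebra, so
    [cond_mean_simple] applies to them. *)
Definition simple_approx : {nnsfun (g_sigma_algebraType G) >-> R}^nat :=
  nnsfun_approx measurableT mg'.

Lemma cvg_simple_approx w : simple_approx n w @[n --> \oo] --> g w.
Proof.
apply: (@fine_cvg _ _ _ _ (fun n => (simple_approx n w)%:E)).
by apply: cvg_nnsfun_approx => // x _ /=; rewrite lee_fin.
Qed.

Lemma nd_simple_approx w :
  {homo simple_approx^~ w : m n / (m <= n)%N >-> m <= n}.
Proof. by move=> m n mn; have /lefP := nd_nnsfun_approx measurableT mg' mn. Qed.

Lemma simple_approx_le n w : simple_approx n w <= g w.
Proof.
have cg := @cvg_simple_approx w.
rewrite -(cvg_lim _ cg)//; apply: nondecreasing_cvgn_le.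
  exact: nd_simple_approx.
by apply/cvg_ex; exists (g w).
Qed.

Lemma simple_approx_ge0 n w : 0 <= simple_approx n w.
Proof. exact: fun_ge0. Qed.

End Approximation.

(** Dominated convergence along the simple approximations of [g], with the product itself as
    dominating function. *)
Lemma cond_mean_pullout_ge0 G f c g : is_sub_sigma_algebra G ->
  cond_mean G f c -> measurable_for G g -> (forall w, 0 <= g w) ->
  integrableR g -> integrableR (fun w => f w * g w) ->
  \int[P]_w (f w * g w) = c * \int[P]_w g w.
Proof.
move=> Gs fc mg g0 gi fgi; pose h := simple_approx mg.
have mh n : measurable_fun setT (h n : T -> R).
  apply: (measurable_for_measurable Gs).
  exact: (@measurable_funP _ _ _ _ setT (h n)).
have key f' : integrableR (fun w => f' w * g w) -> measurable_fun setT f' ->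
    \int[P]_w (f' w * h n w) @[n --> \oo] --> \int[P]_w (f' w * g w).
  move=> f'gi mf'.
  apply: fine_cvg; rewrite fineK; last exact: integrable_fin_num.
  have [n||||
    |_ _] := @dominated_convergence _ _ _ P _ measurableT
    (fun n w => (f' w * h n w)%:E) (fun w => (f' w * g w)%:E)
    (fun w => `|f' w * g w|%:E).
  - exact/measurable_EFinP/measurable_funM.
  - exact: measurable_int f'gi.
  - apply: aeW => w _; apply: cvg_EFin; first exact: nearW.
    by apply: cvgMr; exact: cvg_simple_approx.
  - exact: (integrable_abse f'gi).
  - apply: aeW => w n _; rewrite lee_fin !normrM ler_wpM2l//.
    rewrite ger0_norm ?simple_approx_ge0// ger0_norm//.
    exact: simple_approx_le.
  - exact.
have f1 := key _ fgi (integrableR_measurable fc.1).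
(* The same limit with the constant 1 in place of [f] handles the right-hand side. *)
have /cvgMr : \int[P]_w (1 * h n w) @[n --> \oo] --> \int[P]_w (1 * g w).
  by apply: key => //; under eq_fun do rewrite mul1r.
move=> /(_ c) f2.
have e (k : T -> R) : \int[P]_w (1 * k w) = \int[P]_w k w.
  by apply: eq_Rintegral => w _; rewrite mul1r.
rewrite e in f2.
have hE n : \int[P]_w (f w * h n w) = c * \int[P]_w (1 * h n w).
  by rewrite e; have [_ ->] := cond_mean_simple (h n) Gs fc.
move: f1; under eq_cvg do rewrite hE; move=> f1.
by rewrite -(cvg_lim _ f1)// (cvg_lim _ f2).
Qed.

Lemma cond_mean_pullout G f c g : is_sub_sigma_algebra G ->
  cond_mean G f c -> measurable_for G g ->
  integrableR g -> integrableR (fun w => f w * g w) ->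
  \int[P]_w (f w * g w) = c * \int[P]_w g w.
Proof.
move=> Gs fc mg gi fgi.
have mgP : measurable_for G g^\+ by exact: measurable_funrpos.
have mgN : measurable_for G g^\- by exact: measurable_funrneg.
have mf := integrableR_measurable fc.1.
have mP := measurable_for_measurable Gs mgP.
have mN := measurable_for_measurable Gs mgN.
have gP w : `|g^\+ w| <= `|g w|.
  by rewrite ger0_norm ?funrpos_ge0// ge_max ler_norm normr_ge0.
have gN w : `|g^\- w| <= `|g w|.
  by rewrite ger0_norm ?funrneg_ge0// ge_max ler_normr lexx orbT normr_ge0.
have ia (k k' : T -> R) : measurable_fun setT k ->
    (forall w, `|k w| <= `|k' w|) ->
    integrableR k' -> integrableR k.
  move=> mk kk' k'i; apply: integrableR_le kk' _ => //.
  exact: (integrable_abse k'i).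
have gPi : integrableR g^\+ by exact: (ia _ _ mP gP gi).
have gNi : integrableR g^\- by exact: (ia _ _ mN gN gi).
have fgPi : integrableR (fun w => f w * g^\+ w).
  apply: ia fgi; first exact: measurable_funM.
  by move=> w; rewrite !normrM ler_wpM2l.
have fgNi : integrableR (fun w => f w * g^\- w).
  apply: ia fgi; first exact: measurable_funM.
  by move=> w; rewrite !normrM ler_wpM2l.
have gE w : g w = g^\+ w - g^\- w by rewrite -[in LHS](funrposBneg g).
rewrite (_ : \int[P]_w (f w * g w) =
  \int[P]_w (f w * g^\+ w - f w * g^\- w)); last first.
  by apply: eq_Rintegral => w _; rewrite gE mulrBr.
rewrite (_ : \int[P]_w g w = \int[P]_w (g^\+ w - g^\- w)); last first.
  by apply: eq_Rintegral => w _; rewrite gE.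
rewrite !RintegralB// mulrBr.
by rewrite !(cond_mean_pullout_ge0 Gs fc).
Qed.

(* Integrability of the product comes for free when both factors are
   nonnegative: the simple approximations of [g] have bounded integrals. *)
Lemma cond_mean_integrableM G f c g : is_sub_sigma_algebra G ->
  cond_mean G f c -> (forall w, 0 <= f w) ->
  measurable_for G g -> (forall w, 0 <= g w) -> integrableR g ->
  integrableR (fun w => f w * g w).
Proof.
move=> Gs fc f0 mg g0 gi; pose h := simple_approx mg.
have mh n : measurable_fun setT (h n : T -> R).
  apply: (measurable_for_measurable Gs).
  exact: (@measurable_funP _ _ _ _ setT (h n)).
have mf := integrableR_measurable fc.1.
(* Over the whole space, [c] is the integral of the nonnegative [f]. *)
have c0 : 0 <= c.
  have := fc.2 setT; rewrite probability_setT/= mulr1 => <-.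
    by apply: Rintegral_ge0.
  by case: Gs => -[] G0 GC _ _; rewrite -(setD0 setT); exact: GC.
apply/integrableP; split.
  apply/measurable_EFinP/measurable_funM => //.
  exact: (measurable_for_measurable Gs mg).
apply: (@le_lt_trans _ _ (c * \int[P]_w g w)%:E); last exact: ltry.
have cv : (\int[P]_w (f w * h n w)%:E @[n --> \oo] -->
    \int[P]_w `|(f w * g w)%:E|)%E.
  have := @cvg_monotone_convergence _ _ _ P setT measurableT
    (fun n w => (f w * h n w)%:E).
  have -> : (\int[P]_w limn (fun n => (f w * h n w)%:E) =
      \int[P]_w `|(f w * g w)%:E|)%E.
    apply: eq_integral => w _; rewrite abse_EFin ger0_norm ?mulr_ge0//.
    apply/cvg_lim => //; apply: cvg_EFin; first exact: nearW.
    by apply: cvgMr; exact: cvg_simple_approx.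
  apply=> [n|n w _|w _ m n mn].
  - exact/measurable_EFinP/measurable_funM.
  - by rewrite lee_fin mulr_ge0// simple_approx_ge0.
  - by rewrite lee_fin ler_wpM2l// nd_simple_approx.
apply: (cvge_le _ cv); apply: nearW => n.
have [i e] := cond_mean_simple (h n) Gs fc.
rewrite -[leLHS]fineK; last exact: integrable_fin_num i.
rewrite lee_fin [leLHS]e ler_wpM2l//; apply: le_Rintegral => //.
  apply: integrableR_le gi => // w; rewrite ger0_norm ?simple_approx_ge0//.
  exact: simple_approx_le.
by move=> w _; exact: simple_approx_le.
Qed.

End ConditionalMean.

(** * Second moments *)

Section Moments.
Context {R : realType} {d : measure_display} {T : measurableType d}.
Variable P : probability T R.
Local Notation integrableR f := (P.-integrable setT (EFin \o f)).

Lemma integrable_sqrM (u v : T -> R) :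
  measurable_fun setT u -> measurable_fun setT v ->
  integrableR (fun w => u w ^+ 2) -> integrableR (fun w => v w ^+ 2) ->
  integrableR (fun w => u w * v w).
Proof.
move=> mu mv ui vi; apply: integrableR_le (integrableRD ui vi).
  exact: measurable_funM.
move=> w; rewrite normrM -[u w ^+ 2]real_normK ?num_real//.
rewrite -[v w ^+ 2]real_normK ?num_real//.
by move: `|u w| `|v w| => x y; nra.
Qed.

Variables (n : nat) (G : nat -> set_system T).
Hypothesis Gs : forall j, is_sub_sigma_algebra (G j).
Hypothesis Gmono : forall j, G j `<=` G j.+1.
Variable b : nat -> 'I_n -> 'I_n -> T -> R.
Hypothesis mb : forall j i k, measurable_for (G j.+1) (b j i k).
Variable s : 'I_n -> 'I_n -> 'I_n -> 'I_n -> R.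
Hypothesis bs : forall j i k i' k',
  cond_mean P (G j) (fun w => b j i k w * b j i' k' w) (s i k i' k').

(** The recursion in coordinates: [b j] plays the matrix of the random one-step operator, and [s]
    holds the conditional means of products of its entries. *)
Definition trajectory (x : nat -> 'I_n -> T -> R) :=
  [/\ forall i, measurable_for (G 0) (x 0 i),
      forall i, integrableR (fun w => x 0 i w ^+ 2) &
      forall j i w, x j.+1 i w = \sum_k b j i k w * x j k w].

Lemma trajectory_measurable x j i :
  trajectory x -> measurable_for (G j) (x j i).
Proof.
move=> [x0 _ xS]; elim: j i => [//|j IH] i.
rewrite (_ : x j.+1 i = fun w => \sum_k b j i k w * x j k w); last first.
  by apply/funext => w; exact: xS.
apply: measurable_sum => k; apply: measurable_funM; first exact: mb.
have /(measurable_forP _ (Gs _)) xG := IH k.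
by apply/(measurable_forP _ (Gs _)) => U mU; apply: Gmono; exact: xG.
Qed.

Lemma trajectory_measurable_fun x j i :
  trajectory x -> measurable_fun setT (x j i).
Proof.
move=> xt; apply: (measurable_for_measurable (Gs j)).
exact: trajectory_measurable.
Qed.

Let mb' j i k : measurable_fun setT (b j i k).
Proof. exact: (measurable_for_measurable (Gs j.+1)). Qed.

(** The product of [b j i k w ^+ 2], of constant conditional mean, and [x j k w ^+ 2], measurable
    for [G j], is integrable by [cond_mean_integrableM]. *)
Lemma trajectory_sqr_step x j i k : trajectory x ->
  (forall k, integrableR (fun w => x j k w ^+ 2)) ->
  integrableR (fun w => (b j i k w * x j k w) ^+ 2).
Proof.
move=> xt xi; under [X in integrableR X]eq_fun do rewrite exprMn.
apply: (@cond_mean_integrableM _ _ _ _ (G j) _ (s i k i k)) => //.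
- by under eq_fun do rewrite expr2; exact: bs.
- by move=> w; exact: sqr_ge0.
- by apply: measurable_funX; exact: trajectory_measurable.
- by move=> w; exact: sqr_ge0.
Qed.

(** Each term of the expanded product is grouped in two ways: as [(b x) (b' y)], a product of
    square-integrable factors, for integrability, and as [(b b') (x y)] to pull out the conditional
    mean. *)
Lemma trajectory_step x y j i i' : trajectory x -> trajectory y ->
  (forall k, integrableR (fun w => x j k w ^+ 2)) ->
  (forall k, integrableR (fun w => y j k w ^+ 2)) ->
  integrableR (fun w => x j.+1 i w * y j.+1 i' w) /\
  \int[P]_w (x j.+1 i w * y j.+1 i' w) =
  \sum_k \sum_k' s i k i' k' * \int[P]_w (x j k w * y j k' w).
Proof.
move=> xt yt xi yi.
have mx k := trajectory_measurable_fun j k xt.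
have my k := trajectory_measurable_fun j k yt.
pose F k k' w := b j i k w * b j i' k' w * (x j k w * y j k' w).
have -> : (fun w => x j.+1 i w * y j.+1 i' w) =
    fun w => \sum_k \sum_k' F k k' w.
  apply/funext => w; have [[_ _ ->] [_ _ ->]] := (xt, yt).
  rewrite mulr_suml; apply: eq_bigr => k _; rewrite mulr_sumr.
  by apply: eq_bigr => k' _; rewrite /F mulrACA.
have Fi k k' : integrableR (F k k').
  rewrite (_ : F k k' = fun w =>
    (b j i k w * x j k w) * (b j i' k' w * y j k' w)).
    apply: integrable_sqrM; [exact: measurable_funM|exact: measurable_funM| |].
      exact: trajectory_sqr_step.
    exact: trajectory_sqr_step.
  by apply/funext => w; rewrite /F mulrACA.
have Fk k := integrableR_sum (index_enum 'I_n) (Fi k).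
have [i1 ->] := integrableR_sum (index_enum 'I_n) (fun k => (Fk k).1).
split=> //; apply: eq_bigr => k _; rewrite (Fk k).2; apply: eq_bigr => k' _.
apply: (cond_mean_pullout (Gs j)) => //.
- by apply: measurable_funM; exact: trajectory_measurable.
- exact: integrable_sqrM.
- exact: Fi.
Qed.

Lemma trajectory_sqr_integrable x j i : trajectory x ->
  integrableR (fun w => x j i w ^+ 2).
Proof.
move=> xt; elim: j i => [|j IH] i; first by case: xt.
under [X in integrableR X]eq_fun do rewrite expr2.
by have [] := trajectory_step i i xt xt IH IH.
Qed.

Lemma moment_recursion x y j i i' : trajectory x -> trajectory y ->
  \int[P]_w (x j.+1 i w * y j.+1 i' w) =
  \sum_k \sum_k' s i k i' k' * \int[P]_w (x j k w * y j k' w).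
Proof.
move=> xt yt.
by have [] := trajectory_step i i' xt yt
  (fun k => trajectory_sqr_integrable j k xt)
  (fun k => trajectory_sqr_integrable j k yt).
Qed.

End Moments.

(** * From vector-valued to scalar conditional expectations *)

Section VectorValued.
Context {R : realType} {d : measure_display} {T : measurableType d}.
Variable P : probability T R.
Implicit Types G : set_system T.
Local Notation integrableR f := (P.-integrable setT (EFin \o f)).

Lemma is_sub_sigma_algebra_measurable :
  is_sub_sigma_algebra (measurable : set_system T).
Proof. by split=> //; exact: sigma_algebra_measurable. Qed.

(** Open half-lines generate the Borel sets of the reals, and a Lipschitz function pulls them back
    to norm-open sets. *)
Lemma lipschitz_measurable_for (E : zmodType) (N : E -> R) G (f : T -> E)
    (g : E -> R) C : is_sub_sigma_algebra G -> 0 < C ->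
  (forall x y, `|g y - g x| <= C * N (y - x)) ->
  measurable_wrt N G f -> measurable_for G (g \o f).
Proof.
move=> [Gs Gm] C0 gL mf; have GE : <<s G>> = G by exact: sigma_algebra_id.
move=> mT; apply: (measurability _ (RGenOInfty.measurableE R)) => //.
move=> _ [_ [a ->] <-]; rewrite setTI.
suff : G ((g \o f) @^-1` `]a, +oo[) by rewrite -[in X in X -> _]GE.
have -> : (g \o f) @^-1` `]a, +oo[ = f @^-1` [set x | a < g x].
  by apply/seteqP; split=> w /=; rewrite in_itv/= andbT.
(* Within this radius [g] changes by less than [g x - a]. *)
apply: mf => x /= ax; exists ((g x - a) / C).
  by rewrite divr_gt0// subr_gt0.
move=> y; rewrite ltr_pdivlMr// mulrC => /(le_lt_trans (gL x y)).
by rewrite ltr_norml => /andP[]; lra.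
Qed.

Lemma cond_mean_cst G c : is_sub_sigma_algebra G -> cond_mean P G (cst c) c.
Proof.
move=> [_ Gm]; split=> [|A GA]; last by rewrite Rintegral_cst//; exact: Gm.
exact: finite_measure_integrable_cst.
Qed.

Section Linear.
Variables (E : vectType R) (l : {scalar E}).

Lemma scalar_vexpectation_on A (f : T -> E) : measurable A ->
  (forall i, integrableR (fun w => coord (vbasis {:E}) i (f w))) ->
  l (vexpectation_on P A f) = (\int[P]_(w in A) l (f w))%R.
Proof.
move=> mA fi; rewrite linear_sum.
have -> : (\int[P]_(w in A) l (f w))%R = (\int[P]_w (l (f w) * \1_A w))%R.
  by rewrite Rintegral_indic.
have fE w : l (f w) * \1_A w = \sum_(i < \dim {:E})
    l (vbasis {:E})`_i * (coord (vbasis {:E}) i (f w) * \1_A w).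
  rewrite [in LHS](coord_vbasis (memvf (f w))) linear_sum mulr_suml.
  by apply: eq_bigr => i _; rewrite linearZ/= mulrA [_ * l _]mulrC.
under [RHS]eq_Rintegral do rewrite fE.
have iA i := integrableR_indic mA (fi i).
have [_ ->] := integrableR_sum (index_enum 'I_(\dim {:E}))
  (fun i => integrableRZ (l (vbasis {:E})`_i) (iA i)).
apply: eq_bigr => i _; rewrite linearZ/= RintegralZl// mulrC.
by rewrite Rintegral_indic.
Qed.

End Linear.

(** A functional on operators is dominated by a multiple of the operator norm, so its composite with
    [f] is measurable and integrable, and it commutes with the coordinatewise integral. Everything
    afterwards is about real random variables. *)
Lemma scalar_cond_mean (W : vectType R) (ip : {dot W for idfun}) G
    (f : T -> 'End(W)) (M : 'End(W)) (l : {scalar 'End(W)}) :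
  is_sub_sigma_algebra G ->
  is_cond_expectation P (opnorm (dot_norm ip)) G f (fun=> M) ->
  cond_mean P G (l \o f) (l M).
Proof.
move=> Gs [[mf fi] _ _ fM].
have mnorm : measurable_fun setT (opnorm (dot_norm ip) \o f).
  apply: (measurable_for_measurable is_sub_sigma_algebra_measurable).
  apply: (lipschitz_measurable_for is_sub_sigma_algebra_measurable ltr01) mf.
  by move=> x y; rewrite mul1r; exact: opnorm_lipschitz.
have fnorm : integrableR (opnorm (dot_norm ip) \o f).
  apply/integrableP; split; first exact/measurable_EFinP.
  move: fi; rewrite unlock; congr (_ < _)%E; apply: eq_integral => w _ /=.
  by rewrite ger0_norm// opnorm_ge0.
have li (k : {scalar 'End(W)}) : integrableR (k \o f).
  have [C C0 kC] := linear_le_opnorm ip k.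
  apply: integrableR_le (integrableRZ C fnorm) => [|w]; last exact: kC.
  apply: (measurable_for_measurable is_sub_sigma_algebra_measurable).
  apply: (lipschitz_measurable_for is_sub_sigma_algebra_measurable C0) mf.
  by move=> x y; rewrite -linearB.
split=> [|A GA]; first exact: li.
have mA := Gs.2 _ GA.
rewrite -[LHS](@scalar_vexpectation_on _ l A f mA)//; last first.
  by move=> i; exact: (li (coord (vbasis {:'End(W)}) i)).
rewrite -fM// scalar_vexpectation_on// => [|i]; first by rewrite Rintegral_cst.
exact: finite_measure_integrable_cst.
Qed.

End VectorValued.

Section OperatorEntry.
Context {R : realType} {W : vectType R} (ip : {dot W for idfun}).
Variables (u v : W) (c : R).

(** The factor [c] lets a cross term, an entry of [Ddet] times an entry of the noise, be a single
    linear functional of the noise. *)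
Definition operator_entry (L : 'End(W)) : R := c * ip (L u) v.

Lemma operator_entry_linear : scalar operator_entry.
Proof.
move=> a L M; rewrite /operator_entry add_lfunE scale_lfunE.
by rewrite linearDl linearZl /=; ring.
Qed.

HB.instance Definition _ :=
  GRing.isLinear.Build _ _ _ _ operator_entry operator_entry_linear.

End OperatorEntry.

(** * Orthonormal bases of the tensor square *)

Section TensorBasis.
Context {R : realType} {V : vectType R} {ip : {dot V for idfun}}.
Variables (V2 : hilbert_tensor_square ip) (I : finType) (e : I -> V).
Hypothesis eP : orthonormal_basis ip e.

Definition tensor_family (p : I * I) : V2 := tensor V2 (e p.1) (e p.2).

(** The expansion formula is additive in [x], so it is enough to check it on simple tensors, where
    it follows by bilinearity. *)
Lemma tensor_basis : orthonormal_basis (tensor_ip V2) tensor_family.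
Proof.
split=> [[i j] [k l]|x].
  by rewrite tensor_ipE/= !eP.1 xpair_eqE -mulnb natrM.
have [s ->] := tensor_span x.
elim/big_ind : _ => [|y z {1}-> {1}->|p _].
- by rewrite big1 // => p _; rewrite linear0l scale0r.
- by rewrite -big_split; apply: eq_bigr => p _; rewrite linearDl scalerDl.
rewrite [in LHS](eP.2 p.1) [in LHS](eP.2 p.2) linear_sumlz.
rewrite -(pair_big xpredT xpredT (fun i j =>
  tensor_ip V2 (tensor V2 p.1 p.2) (tensor_family (i, j)) *:
    tensor_family (i, j)))/=.
apply: eq_bigr => i _; rewrite linear_sum; apply: eq_bigr => j _.
rewrite linearZ /= linearZl /=. by rewrite scalerA tensor_ipE /= mulrC.
Qed.

End TensorBasis.

(** * Entries of the iterates of an operator in an orthonormal basis *)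

Section Iterates.
Context {R : realType} {W : vectType R} (ip : {dot W for idfun}).
Variables (I : finType) (u : I -> W).
Hypothesis uP : orthonormal_basis ip u.
Variable S : 'End(W).

Lemma iter_lfun_sum j (a : I -> R) (f : I -> W) :
  iter j S (\sum_p a p *: f p) = \sum_p a p *: iter j S (f p).
Proof.
elim: j => [//|j IH]; rewrite iterS IH linear_sum.
by apply: eq_bigr => p _; rewrite linearZ.
Qed.

(** The common consequence of [spectral_radius S < 1] and of operator norm below 1, from which
    stability is proved once. *)
Definition geometric_decay := exists2 q, 0 < q < 1 &
  forall p p', exists C, forall j, `|ip (iter j S (u p)) (u p')| <= C * q ^+ j.

Lemma spectral_radius_geometric_decay :
  spectral_radius S < 1 -> geometric_decay.
Proof.
move=> /spectral_radius_lt1_decay[q q01 Sq]; exists q => // p p'.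
have /choice[C CP] k := Sq (u p) k.
exists (\sum_k C k * `|ip (vbasis {:W})`_k (u p')|) => j.
rewrite (coord_vbasis (memvf (iter j S (u p)))) linear_sumlz mulr_suml.
rewrite (le_trans (ler_norm_sum _ _ _))// ler_sum// => k _.
by rewrite linearZl /= normrM mulrAC ler_wpM2r.
Qed.

Lemma opnorm_geometric_decay : opnorm (dot_norm ip) S < 1 -> geometric_decay.
Proof.
(* The norm itself could be 0, whereas the rate has to be positive. *)
move=> S1; exists ((opnorm (dot_norm ip) S + 1) / 2).
  by have := opnorm_ge0 ip S; move: S1; lra.
set q := _ / _ => p p'; exists 1 => j; rewrite mul1r.
apply: (le_trans (coord_le_norm uP _ _)).
elim: j => [|j IH]; first by rewrite /= (basis_norm uP) expr0.
apply: (le_trans (le_opnorm _ _ _)); rewrite exprS.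
apply: ler_pM => //; [exact: opnorm_ge0|exact: dot_norm_ge0|].
by rewrite /q; move: S1; lra.
Qed.

(** Coordinates in [vbasis] are fixed finite combinations of the entries in the basis [u], so
    convergence carries over. *)
Lemma entries_cvg0_spectral_radius :
  (forall p p', ip (iter j S (u p)) (u p') @[j --> \oo] --> (0 : R)) ->
  spectral_radius S < 1.
Proof.
move=> S0; apply: iter_cvg0_spectral_radius => x k.
pose t p p' := ip x (u p) * coord (vbasis {:W}) k (u p').
have E j : coord (vbasis {:W}) k (iter j S x) =
    \sum_p \sum_p' t p p' * ip (iter j S (u p)) (u p').
  rewrite [in LHS](uP.2 x) iter_lfun_sum linear_sum; apply: eq_bigr => p _.
  rewrite linearZ/= [in LHS](uP.2 (iter j S (u p))) linear_sum mulr_sumr.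
  by apply: eq_bigr => p' _; rewrite linearZ/= /t; ring.
have : \sum_p \sum_p' t p p' * ip (iter j S (u p)) (u p') @[j --> \oo]
    --> \sum_p \sum_p' t p p' * 0.
  apply: (@cvg_big R^o) => [|p _]; first exact: add_continuous.
  apply: (@cvg_big R^o) => [|p' _]; first exact: add_continuous.
  by apply: cvgMr; exact: S0.
rewrite big1 => [|p _]; last by rewrite big1// => p' _; rewrite mulr0.
by under [X in _ -> X]eq_cvg do rewrite E.
Qed.

End Iterates.

(** * Stability *)

Section MeanSquareStability.
Context {R : realType} {d : measure_display} {T : measurableType d}.
Variable P : probability T R.
Local Notation integrableR f := (P.-integrable setT (EFin \o f)).
Variables (V : vectType R) (ip : {dot V for idfun}).
Local Notation N := (dot_norm ip).
Variables (n : nat) (e : 'I_n -> V).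
Hypothesis eP : orthonormal_basis ip e.
Variable G : nat -> set_system T.
Hypothesis Gs : forall j, is_sub_sigma_algebra (G j).
Hypothesis Gmono : forall j, G j `<=` G j.+1.
Variables (V2 : hilbert_tensor_square ip) (A : 'End(V)).
Variables (D : nat -> T -> 'End(V)) (M : 'End(V2)).
Hypothesis mD : forall j, measurable_wrt (opnorm N) (G j.+1) (D j).
Hypothesis cD : forall j,
  is_cond_expectation P (opnorm N) (G j) (D j) (fun=> 0).
Hypothesis cDD : forall j,
  is_cond_expectation P (opnorm (dot_norm (tensor_ip V2))) (G j)
    (fun w => tensor_op V2 (D j w) (D j w)) (fun=> M).

Let S : 'End(V2) := tensor_op V2 A A + M.
Let u : 'I_n * 'I_n -> V2 := tensor_family V2 e.
Let uP : orthonormal_basis (tensor_ip V2) u := tensor_basis V2 eP.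
Let b j i k w : R := ip ((A + D j w) (e k)) (e i).
Let s i k i' k' : R := tensor_ip V2 (S (u (k, k'))) (u (i, i')).

(** An entry of [A + L] is a 1-Lipschitz function of [L] in operator norm. *)
Let b_measurable j i k : measurable_for (G j.+1) (b j i k).
Proof.
have := @lipschitz_measurable_for _ _ _ _ _ _ _
  (fun L : 'End(V) => ip ((A + L) (e k)) (e i)) 1 (Gs j.+1) ltr01 _ (mD j).
apply=> L L'; rewrite mul1r -linearBl.
have -> : (A + L') (e k) - (A + L) (e k) = (L' - L) (e k).
  by rewrite !add_lfunE opp_lfunE opprD addrACA subrr add0r.
apply: le_trans (coord_le_norm eP _ _) _.
by rewrite (le_trans (le_opnorm _ _ _))// (basis_norm eP) mulr1.
Qed.

(* With [B := A + D j], [B (x) B] is the sum of [A (x) A], of two cross terms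
   linear in [D j], hence of conditional mean [0], and of [D j (x) D j]. *)
Let b_cond_mean j i k i' k' :
  cond_mean P (G j) (fun w => b j i k w * b j i' k' w) (s i k i' k').
Proof.
pose a := ip (A (e k)) (e i); pose a' := ip (A (e k')) (e i').
have c1 := cond_mean_cst P (a * a') (Gs j).
have c2 := scalar_cond_mean (operator_entry ip (e k') (e i') a) (Gs j) (cD j).
have c3 := scalar_cond_mean (operator_entry ip (e k) (e i) a') (Gs j) (cD j).
have c4 := scalar_cond_mean
  (operator_entry (tensor_ip V2) (u (k, k')) (u (i, i')) 1) (Gs j) (cDD j).
have := cond_meanD (Gs j) (cond_meanD (Gs j) (cond_meanD (Gs j) c1 c2) c3) c4.
congr cond_mean.
  apply/funext => w; rewrite /b /= /operator_entry /u /tensor_family/=.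
  rewrite tensor_opE tensor_ipE !add_lfunE !linearDl /= -/a -/a'.
  by ring.
rewrite !raddf0 !addr0 /= /operator_entry mul1r /s /S add_lfunE linearDl /=.
by rewrite /u /tensor_family /= tensor_opE tensor_ipE.
Qed.

Local Notation sol X0 := (solution A D X0).
Let xs X0 j i w : R := ip (sol X0 j w) (e i).

Lemma mean_squareE (X : T -> V) :
  mean_square P N X = (\int[P]_w (\sum_i ip (X w) (e i) ^+ 2)%:E)%E.
Proof.
rewrite /mean_square unlock; apply: eq_integral => w _; congr EFin.
by rewrite sqr_dot_norm (dot_sumE eP).
Qed.

Lemma mean_square_Rintegral (X : T -> V) :
  (forall i, integrableR (fun w => ip (X w) (e i) ^+ 2)) ->
  mean_square P N X = (\sum_i \int[P]_w (ip (X w) (e i) ^+ 2))%:E.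
Proof.
move=> Xi; have [i <-] := integrableR_sum (index_enum 'I_n) Xi.
by rewrite mean_squareE /Rintegral fineK//; exact: integrable_fin_num.
Qed.

(** Each squared coordinate of [X0] is at most its squared norm, which has finite expectation; the
    recursion is the basis expansion of the current state. *)
Lemma solution_trajectory X0 : initial_condition P N (G 0) X0 ->
  trajectory P G b (xs X0).
Proof.
move=> [mX iX].
have mx i : measurable_for (G 0) (xs X0 0 i).
  apply: (lipschitz_measurable_for (Gs 0) (g := fun v => ip v (e i)) ltr01) mX.
  by move=> x y; rewrite mul1r -linearBl; exact: coord_le_norm.
split=> // [i|j i w].
- have mx' k : measurable_fun setT (fun w => xs X0 0 k w ^+ 2).
    by apply: measurable_funX; exact: measurable_for_measurable (mx k).
  apply/integrableP; split; first exact/measurable_EFinP.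
  apply: le_lt_trans iX; rewrite mean_squareE; apply: ge0_le_integral => //.
  + by apply: measurableT_comp => //; exact/measurable_EFinP.
  + by apply/measurable_EFinP; apply: measurable_sum => k; exact: mx'.
  + move=> w _ /=; rewrite lee_fin ger0_norm ?sqr_ge0// (bigD1 i)//= lerDl.
    by apply: sumr_ge0 => k _; exact: sqr_ge0.
- rewrite /xs /= -add_lfunE [in LHS](eP.2 (sol X0 j w)) linear_sum linear_sumlz.
  by apply: eq_bigr => k _; rewrite linearZ linearZl /= mulrC.
Qed.

Lemma mean_square_solution X0 j : initial_condition P N (G 0) X0 ->
  mean_square P N (sol X0 j) =
  (\sum_i \int[P]_w (xs X0 j i w * xs X0 j i w))%:E.
Proof.
move=> /solution_trajectory xt; rewrite mean_square_Rintegral => [|i].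
  by congr EFin; apply: eq_bigr => i _; under eq_Rintegral do rewrite expr2.
exact: (trajectory_sqr_integrable Gs Gmono b_measurable b_cond_mean j i xt).
Qed.

Lemma moment_iterate X0 Y0 j i i' :
  initial_condition P N (G 0) X0 -> initial_condition P N (G 0) Y0 ->
  \int[P]_w (xs X0 j i w * xs Y0 j i' w) =
  \sum_p \int[P]_w (xs X0 0 p.1 w * xs Y0 0 p.2 w) *
    tensor_ip V2 (iter j S (u p)) (u (i, i')).
Proof.
move=> /solution_trajectory xt /solution_trajectory yt.
(* This is the second moment of the two solutions at time [j], as an element of the tensor
   square. *)
pose m j := \sum_p \int[P]_w (xs X0 j p.1 w * xs Y0 j p.2 w) *: u p.
have mE k p : tensor_ip V2 (m k) (u p) =
    \int[P]_w (xs X0 k p.1 w * xs Y0 k p.2 w).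
  rewrite linear_sumlz (bigD1 p)//= big1 => [|p' pp'].
    by rewrite linearZl /= uP.1 eqxx mulr1 addr0.
  by rewrite linearZl /= uP.1 (negPf pp') mulr0.
have mS k : m k.+1 = S (m k).
  rewrite [RHS](uP.2 (S (m k))); apply: eq_bigr => p _; congr (_ *: _).
  rewrite (moment_recursion Gs Gmono b_measurable b_cond_mean)//.
  rewrite linear_sum linear_sumlz pair_big /=; apply: eq_bigr => -[k1 k2] _.
  by rewrite linearZ linearZl /= mulrC; case: p.
have mj : m j = iter j S (m 0).
  by elim: j => [//|j IH]; rewrite mS IH.
rewrite -[LHS](mE j (i, i')) mj iter_lfun_sum linear_sumlz.
by apply: eq_bigr => p _; rewrite linearZl.
Qed.

(** By the bound of [|x y|] by the sum of squares, mean squares control all mixed moments. At time 0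
    this bounds the initial data; at later times it transfers stability to the entries of the
    iterates. *)
Lemma moment_le X0 Y0 j i i' :
  initial_condition P N (G 0) X0 -> initial_condition P N (G 0) Y0 ->
  `|\int[P]_w (xs X0 j i w * xs Y0 j i' w)| <=
  fine (mean_square P N (sol X0 j)) + fine (mean_square P N (sol Y0 j)).
Proof.
move=> X0i Y0i; rewrite !mean_square_solution//=.
have [xt yt] := (solution_trajectory X0i, solution_trajectory Y0i).
have ti X k : trajectory P G b X -> integrableR (fun w => X j k w ^+ 2).
  move=> Xt.
  exact: (trajectory_sqr_integrable Gs Gmono b_measurable b_cond_mean j k Xt).
have tm X k : trajectory P G b X -> measurable_fun setT (X j k).
  exact: (trajectory_measurable_fun Gs Gmono b_measurable j k).
have xyi : integrableR (fun w => xs X0 j i w * xs Y0 j i' w).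
  by apply: integrable_sqrM; [exact: tm|exact: tm|exact: ti|exact: ti].
have le1 X k : trajectory P G b X ->
    \int[P]_w (X j k w ^+ 2) <= \sum_k' \int[P]_w (X j k' w * X j k' w).
  move=> Xt; rewrite (bigD1 k)//=; under eq_Rintegral do rewrite expr2.
  rewrite lerDl sumr_ge0// => k' _; apply: Rintegral_ge0 => w _.
  by rewrite -expr2 sqr_ge0.
apply: (@le_trans _ _ (\int[P]_w (xs X0 j i w ^+ 2 + xs Y0 j i' w ^+ 2))).
  apply: le_trans (le_normr_Rintegral measurableT xyi) _.
  apply: le_Rintegral => //; first exact: (integrable_abse xyi).
    by apply: integrableRD; exact: ti.
  move=> w _; rewrite normrM -[xs X0 _ _ _ ^+ 2]real_normK ?num_real//.
  rewrite -[xs Y0 _ _ _ ^+ 2]real_normK ?num_real//.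
  by move: `|xs X0 _ _ _| `|xs Y0 _ _ _| => x y; nra.
by rewrite RintegralD//; [apply: lerD; exact: le1|exact: ti|exact: ti].
Qed.

Lemma decay_mean_square_bound : geometric_decay (tensor_ip V2) u S ->
  exists2 q, 0 < q < 1 & exists2 K, 0 <= K & forall X0 j,
    initial_condition P N (G 0) X0 ->
    fine (mean_square P N (sol X0 j)) <= K * fine (mean_square P N X0) * q ^+ j.
Proof.
move=> [q q01 Sq]; exists q => //.
have /choice[C CP] p : exists C, forall p' j,
    `|tensor_ip V2 (iter j S (u p)) (u p')| <= C p' * q ^+ j.
  by have /choice[C CP] := Sq p; exists C.
have C0 p p' : 0 <= C p p'.
  by have := CP p p' 0; rewrite expr0 mulr1; exact: le_trans.
(* The mean square only sees the diagonal moments [(i, i)]; the 2 comes from [moment_le] with equal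
   solutions. The constant does not depend on [X0]. *)
exists (\sum_i \sum_p 2 * C p (i, i)) => [|X0 j X0i].
  by apply: sumr_ge0 => i _; apply: sumr_ge0 => p _; rewrite mulr_ge0.
rewrite {1}mean_square_solution//= -mulrA mulr_suml; apply: ler_sum => i _.
rewrite moment_iterate// mulr_suml; apply: ler_sum => p _.
have := moment_le 0 p.1 p.2 X0i X0i; rewrite -mulr2n.
set r := fine _ => mr; apply: le_trans (ler_norm _) _; rewrite normrM.
have -> : 2 * C p (i, i) * (r * q ^+ j) = (r *+ 2) * (C p (i, i) * q ^+ j).
  by ring.
exact: ler_pM.
Qed.

Lemma initial_mean_square_fin X0 j : initial_condition P N (G 0) X0 ->
  mean_square P N (sol X0 j) \is a fin_num.
Proof. by move=> X0i; rewrite mean_square_solution. Qed.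

Lemma decay_stable : geometric_decay (tensor_ip V2) u S ->
  asymptotically_mean_square_stable P N (G 0) A D.
Proof.
move=> /decay_mean_square_bound[q /andP[q0 q1] [K K0 bound]].
have qj j : q ^+ j <= 1 by rewrite exprn_ile1// ltW.
have ms0 X : 0 <= fine (mean_square P N X).
  by rewrite fine_ge0// /mean_square expectation_ge0// => w; exact: sqr_ge0.
split.
  (* [K] may be 0, hence the denominator [K + 1]. *)
  move=> eps eps0; exists (eps / (K + 1)).
    by rewrite divr_gt0// ltr_wpDl.
  move=> X0 X0i Xd j; have := Xd.
  rewrite -[mean_square P N X0]fineK; last first.
    exact: (initial_mean_square_fin 0 X0i).
  rewrite lte_fin ltr_pdivlMr ?ltr_wpDl// => Xe.
  rewrite -[ltLHS]fineK; last exact: initial_mean_square_fin.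
  rewrite lte_fin (le_lt_trans (bound X0 j X0i))// (le_lt_trans _ Xe)//.
  apply: (@le_trans _ _ (K * fine (mean_square P N X0))).
    by rewrite ler_piMr// mulr_ge0.
  by rewrite mulrC ler_wpM2l// lerDl.
(* Any radius works, since the bound holds for every initial condition. *)
exists 1 => // X0 X0i _; apply/fine_cvgP; split.
  by apply: nearW => j; exact: initial_mean_square_fin.
apply: (@squeeze_cvgr _ _ _ _ (cst 0)
  (fun j => K * fine (mean_square P N X0) * q ^+ j)); last 2 first.
- exact: cvg_cst.
- rewrite -(mulr0 (K * fine (mean_square P N X0))); apply: cvgMr.
  by apply: cvg_expr; rewrite ger0_norm// ltW.
by apply: nearW => j /=; rewrite ms0/=; exact: bound.
Qed.

Lemma mean_square_cst v : mean_square P N (cst v) = (N v ^+ 2)%:E.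
Proof. by rewrite -[RHS](expectation_cst P). Qed.

(** Preimages under a constant are empty or the whole space, and both lie in every sigma-algebra. *)
Lemma cst_initial_condition v : initial_condition P N (G 0) (cst v).
Proof.
split; last by rewrite mean_square_cst ltry.
move=> U _; have [[G0 GC _] _] := Gs 0.
have [Uv|nUv] := pselect (U v).
  rewrite (_ : _ @^-1` U = setT `\` set0); first exact: GC.
  by rewrite setD0; apply/seteqP; split.
by rewrite (_ : _ @^-1` U = set0)//; apply/seteqP; split.
Qed.

Lemma stable_spectral_radius :
  asymptotically_mean_square_stable P N (G 0) A D -> spectral_radius S < 1.
Proof.
move=> [_ [del del0 stable]].
apply: (entries_cvg0_spectral_radius uP) => -[k k'] [i i'].
(* Both [c <= del / 2] and [c <= 1 / 2] hold, hence [c ^+ 2 < del], and the scaled basis vectors are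
   admissible initial values. *)
pose c := Num.min del 1 / 2.
have c0 : 0 < c by rewrite divr_gt0// lt_min del0 ltr01.
have c2 : c ^+ 2 < del.
  have cd : c + c <= del by rewrite -splitr ge_min lexx.
  have c1 : c + c <= 1 by rewrite -splitr ge_min lexx orbT.
  by nra.
pose X0 k : T -> V := cst (c *: e k).
have ic l : initial_condition P N (G 0) (X0 l) by exact: cst_initial_condition.
have ms l : fine (mean_square P N (sol (X0 l) j)) @[j --> \oo] --> (0 : R).
  apply: fine_cvg; apply: stable; first exact: ic.
  by rewrite mean_square_cst lte_fin dot_normZ (basis_norm eP) mulr1 gtr0_norm.
have ceE l l' : ip (c *: e l) (e l') = c * (l == l')%:R.
  by rewrite linearZl /= eP.1.
(* The initial moment is [c ^+ 2] times a single basis tensor, so only the index [(k, k')] survives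
   in the sum. *)
have mE j : \int[P]_w (xs (X0 k) j i w * xs (X0 k') j i' w) =
    c ^+ 2 * tensor_ip V2 (iter j S (u (k, k'))) (u (i, i')).
  rewrite moment_iterate// (bigD1 (k, k'))//= big1 => [|[l l'] ll'].
    rewrite addr0 /xs /X0 /= Rintegral_cst// !ceE !eqxx !mulr1 -expr2.
    by rewrite [fine _](congr1 fine (probability_setT P)) mulr1.
  rewrite /xs /X0 /= Rintegral_cst// !ceE [k == l]eq_sym [k' == l']eq_sym.
  move: ll'; rewrite xpair_eqE negb_and => /orP[] /negPf ->;
    by rewrite ?(mulr0, mul0r).
have -> : (fun j => tensor_ip V2 (iter j S (u (k, k'))) (u (i, i'))) =
    (fun j => c ^- 2 * \int[P]_w (xs (X0 k) j i w * xs (X0 k') j i' w)).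
  by apply/funext => j; rewrite mE mulKf// expf_neq0// gt_eqF.
rewrite -(mulr0 (c ^- 2)); apply: cvgMr; apply/norm_cvg0P.
apply: (@squeeze_cvgr _ _ _ _ (cst 0)
  (fun j => fine (mean_square P N (sol (X0 k) j)) +
            fine (mean_square P N (sol (X0 k') j)))); last 2 first.
- exact: cvg_cst.
- by rewrite -[X in _ --> X]addr0; apply: cvgD; exact: ms.
by apply: nearW => j /=; rewrite normr_ge0/=; exact: moment_le.
Qed.

End MeanSquareStability.

(** * Stability of the recursion along the filtration sampled at the times [t j] *)

Theorem corollary2p6 (R : realType)
  (d : measure_display) (Omega : measurableType d) (P : probability Omega R)
  (F : R -> set_system Omega) (usualF : usual_conditions P F)
  (H : completeNormedModType R) (ip : {dot H for idfun})
  (ip_norm : forall x : H, `|x| ^+ 2 = ip x x) (sepH : separable H)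
  (Sh : R -> pred H) (h : R) (h01 : 0 < h <= 1) (Vh : subVectType (Sh h))
  (dt : R) (dt_gt0 : 0 < dt) :
  let t j : R := j%:R * dt in
  let normV (v : Vh) : R := `|\val v| in
  forall (V2 : hilbert_tensor_square (sub_ip (W := Vh) ip))
    (Ddet : 'End(Vh)) (Dstoch : nat -> Omega -> 'End(Vh)),
  let normL := opnorm normV in
  let normL2 := opnorm (@tensor_norm R Vh _ V2) in
  let DD j (w : Omega) : 'End(V2) := tensor_op V2 (Dstoch j w) (Dstoch j w) in
  (forall j, measurable_wrt normL (F (t j.+1)) (Dstoch j)) ->
  (forall j, is_cond_expectation P normL (F (t j)) (Dstoch j) (fun=> 0)) ->
  (forall j, ('E_P[fun w => (normL (Dstoch j w) ^+ 2)%R] < +oo)%E) ->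
  (forall j, is_cond_expectation P normL2 (F (t j)) (DD j)
    (fun=> vexpectation P (DD j))) ->
  (forall j, vexpectation P (DD j) = vexpectation P (DD 0%N)) ->
  let S := tensor_op V2 Ddet Ddet + vexpectation P (DD 0%N) in
  let stable :=
    asymptotically_mean_square_stable P normV (F 0) Ddet Dstoch in
  (stable <-> spectral_radius S < 1) /\ (normL2 S < 1 -> stable).
Proof.
move=> t normV V2 Ddet Dstoch normL normL2 DD mD cD _ cDD EDD S stable.
(* The norm inherited from [H] is the one induced by the restricted inner product. *)
have normVE : normV = dot_norm (sub_ip (W := Vh) ip).
  apply/funext => v; rewrite -[RHS]/(Num.sqrt (ip (\val v) (\val v))).
  by rewrite -ip_norm sqrtr_sqr normr_id.
have t0 j : 0 <= t j by rewrite mulr_ge0// ltW.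
have tS j : t j <= t j.+1 by rewrite ler_wpM2r ?ler_nat// ltW.
have F0 : F (t 0%N) = F 0 by rewrite /t mul0r.
have Gs j : is_sub_sigma_algebra (F (t j)).
  split; first exact: filtration_sigma usualF _ (t0 j).
  exact: filtration_sub usualF _ (t0 j).
have Gmono j : F (t j) `<=` F (t j.+1).
  exact: filtration_mono usualF _ _ (t0 j) (tS j).
have [k [e eP]] := orthonormal_basis_exists (sub_ip (W := Vh) ip).
(* Stationarity of the second moments replaces the conditional expectation at step [j] by the one
   constant that occurs in [S]. *)
have cM j : is_cond_expectation P normL2 (F (t j)) (DD j)
    (fun=> vexpectation P (DD 0%N)).
  by rewrite -(EDD j); exact: cDD.
rewrite /stable -F0 normVE; rewrite /normL normVE in mD cD.
have sufficient := decay_stable eP Gs Gmono mD cD cM.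
split; first split.
- exact: (stable_spectral_radius eP Gs Gmono mD cD cM).
- by move=> S1; apply: sufficient; exact: spectral_radius_geometric_decay.
- move=> S1; apply: sufficient; apply: opnorm_geometric_decay S1.
  exact: tensor_basis.
Qed.
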